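(* Let $(x^k)_{k\in\mathbb N}$ be generated by the asynchronous block-coordinate forward-backward algorithm described in the context. Suppose that $$\delta:=\max_{i\in[m]}\Big(L_i\gamma_i+2\gamma_i\tau L_{\mathrm{res}}\frac{p_{\max}}{\sqrt{p_{\min}}}\Big)<2,$$ and that there are a set $X\subset H$ with $\{x^k\mid k\in\mathbb N\}\subset X$ $\mathsf P$-a.s. and a constant $C_X>0$ such that the following error bound condition holds: $$(\forall x\in X)\qquad \operatorname{dist}_{\Gamma^{-1}}(x,\operatorname{argmin}F)\le C_X\,\big\|x-\operatorname{prox}_g^{\Gamma^{-1}}\big(x-\nabla^{\Gamma^{-1}}f(x)\big)\big\|_{\Gamma^{-1}} .$$ Then: (i) for all $k\in\mathbb N$, $$\mathsf E\big[F(x^{k+1})-F^*\big]\le\Big(1-\frac{p_{\min}}{\kappa+\theta}\Big)^{\lfloor\frac{k+1}{\tau+1}\rfloor}\mathsf E\big[F(x^0)-F^*\big],$$ where $$\kappa=1+\frac{(2C_X+\delta-2)_+}{2-\delta}=\max\Big\{1,\frac{2C_X}{2-\delta}\Big\},$$ $$\theta=\frac{\tau L_{\mathrm{res}}\gamma_{\max}}{2-\delta}\Big(\frac{p_{\max}^2}{\sqrt{p_{\min}}}+1\Big)\le\frac{\sqrt{p_{\min}}}{p_{\max}(2-\delta)}\Big(\frac{p_{\max}^2}{\sqrt{p_{\min}}}+1\Big);$$ (ii) the sequence $(x^k)_{k\in\mathbb N}$ converges strongly $\mathsf P$-a.s. to a random variable $x^*$ that takes values in $\operatorname{argmin}F$,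 and, as $k\to+\infty$, $$\mathsf E\big[\|x^k-x^*\|_{\Gamma^{-1}}\big]=\mathcal O\Big(\Big(1-\frac{p_{\min}}{\kappa+\theta}\Big)^{\lfloor\frac{k}{\tau+1}\rfloor/2}\Big).$$
   Context: Let $m\ge1$ and $[m]=\{1,\dots,m\}$. $H_1,\dots,H_m$ are separable real Hilbert spaces and $H=\bigoplus_{i=1}^m H_i$ is their direct sum, with elements $x=(x_1,\dots,x_m)$ and inner product $\langle x,y\rangle=\sum_{i=1}^m\langle x_i,y_i\rangle$; $\|\cdot\|$ is the norm of $H$ and $|\cdot|$ the norm of each $H_i$. Objective: $F=f+g$ with $g(x)=\sum_{i=1}^m g_i(x_i)$, where (1) $f:H\to\mathbb R$ is convex and differentiable, and $\nabla_i f(x)\in H_i$ denotes the $i$-th component of $\nabla f(x)$; (2) each $g_i:H_i\to\,]-\infty,+\infty]$ is proper, convex and lower semicontinuous; (3) there are constants $L_{\mathrm{res}}>0$ and $L_1,\dots,L_m$ such that for all $x\in H$ and $i\in[m]$ the map $H_i\ni u\mapsto\nabla f(x_1,\dots,x_{i-1},u,x_{i+1},\dots,x_m)\in H$ is Lipschitz with constant $L_{\mathrm{res}}$ and the map $H_i\ni u\mapsto\nabla_i f(x_1,\dots,x_{i-1},u,x_{i+1},\dots,x_m)\in H_i$ is Lipschitz with constant $L_i$; moreover $\max_i L_i\le L_{\mathrm{res}}$; (4) $F$ attains its minimum $F^*=\min F$ on $H$. For proper convex lower semicontinuous $\varphi$, $\operatorname{prox}_\varphi(x)=\operatorname{argmin}_y\{\varphi(y)+\tfrac12\|y-x\|^2\}$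 (with the norm of the space on which $\varphi$ is defined). Algorithm: $(i_k)_{k\in\mathbb N}$ are i.i.d. random variables on a probability space $(\Omega,\mathfrak A,\mathsf P)$ with values in $[m]$, with $p_i=\mathsf P(i_k=i)>0$ for each $i\in[m]$; $p_{\max}=\max_i p_i$, $p_{\min}=\min_i p_i$. $\tau\in\mathbb N$ (possibly $0$), and $d^k=(d^k_1,\dots,d^k_m)\in\mathbb N^m$, $k\in\mathbb N$, are deterministic delay vectors with $\max_i d^k_i\le\min\{k,\tau\}$. The stepsizes are $\gamma_i>0$, $i\in[m]$, $\gamma_{\max}=\max_i\gamma_i$, and $x^0\in H$ is constant (deterministic) with $F(x^0)<+\infty$. For $k=0,1,2,\dots$, set $x^{k-d^k}=(x_1^{k-d^k_1},\dots,x_m^{k-d^k_m})$ and $$x_i^{k+1}=\begin{cases}\operatorname{prox}_{\gamma_{i}g_{i}}\big(x^k_{i}-\gamma_{i}\nabla_{i}f(x^{k-d^k})\big)&\text{if }i=i_k,\\ x_i^k&\text{if }i\ne i_k.\end{cases}$$ Weighted objects: $\|x\|_{\Gamma^{-1}}^2=\sum_{i=1}^m\frac1{\gamma_i}|x_i|^2$; $\operatorname{dist}_{\Gamma^{-1}}(x,S)=\inf_{z\in S}\|x-z\|_{\Gamma^{-1}}$; $\nabla^{\Gamma^{-1}}f$ is the gradient of $f$ with respect to the inner product associated with $\|\cdot\|_{\Gamma^{-1}}$, i.e. $\nabla^{\Gamma^{-1}}f(x)=(\gamma_i\nabla_if(x))_{i\in[m]}$; $\operatorname{prox}_g^{\Gamma^{-1}}(x)=\operatorname{argmin}_y\{g(y)+\tfrac12\|y-x\|_{\Gamma^{-1}}^2\}$,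 i.e. $(\operatorname{prox}_{\gamma_ig_i}(x_i))_{i\in[m]}$. For $t\in\mathbb R$, $t_+=\max\{t,0\}$. *)

(* Defs.v *)
From HB Require Import structures.
From mathcomp Require Import all_boot all_order all_algebra finmap ring.
From mathcomp Require Import all_classical all_reals all_analysis.
Set Implicit Arguments.
Unset Strict Implicit.
Unset Printing Implicit Defensive.
Import Order.TTheory GRing.Theory Num.Theory.
Import numFieldNormedType.Exports.
Local Open Scope classical_set_scope.
Local Open Scope ring_scope.

HB.mixin Record hasInnerProduct (R : realType) V & NormedModule R V := {
  inner : {dot V for idfun};
  inner_normE : forall x : V, inner x x = `|x| ^+ 2
}.

#[short(type="hilbertType")]
HB.structure Definition Hilbert (R : realType) :=
  {V of CompleteNormedModule R V & hasInnerProduct R V}.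

(* A named alias: the bare product [forall i, H i] already carries the product
   uniform structure, whereas [direct_sum H] is normed by the l^2 norm. *)
Definition direct_sum (R : realType) (I : finType) (H : I -> hilbertType R) : Type :=
  forall i, H i.

Section direct_sum.
Context (R : realType) (I : finType) (H : I -> hilbertType R).
Local Notation T := (direct_sum H).
Implicit Types x y z : T.

HB.instance Definition _ := gen_eqMixin T.
HB.instance Definition _ := gen_choiceMixin T.

Definition direct_sum_add x y : T := fun i => x i + y i.
Definition direct_sum_opp x : T := fun i => - x i.
Definition direct_sum_zero : T := fun i => 0.
Definition direct_sum_scale (a : R) x : T := fun i => a *: x i.

Local Notation add := direct_sum_add.
Local Notation opp := direct_sum_opp.
Local Notation zero := direct_sum_zero.
Local Notation scale := direct_sum_scale.

Let addA : associative add.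
Proof. by move=> x y z; apply/functional_extensionality_dep => i; exact: addrA. Qed.
Let addC : commutative add.
Proof. by move=> x y; apply/functional_extensionality_dep => i; exact: addrC. Qed.
Let add0 : left_id zero add.
Proof. by move=> x; apply/functional_extensionality_dep => i; exact: add0r. Qed.
Let addN : left_inverse zero opp add.
Proof. by move=> x; apply/functional_extensionality_dep => i; exact: addNr. Qed.

HB.instance Definition _ := GRing.isZmodule.Build T addA addC add0 addN.

Let scaleA a b x : scale a (scale b x) = scale (a * b) x.
Proof. by apply/functional_extensionality_dep => i; exact: scalerA. Qed.
Let scale1 : left_id 1 scale.
Proof. by move=> x; apply/functional_extensionality_dep => i; exact: scale1r. Qed.
Let scaleDr : right_distributive scale +%R.
Proof. by move=> a x y; apply/functional_extensionality_dep => i; exact: scalerDr. Qed.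
Let scaleDl x : {morph scale^~ x : a b / a + b}.
Proof. by move=> a b; apply/functional_extensionality_dep => i; exact: scalerDl. Qed.

HB.instance Definition _ :=
  GRing.Zmodule_isLmodule.Build R T scaleA scale1 scaleDr scaleDl.

Definition direct_sum_norm x : R := Num.sqrt (\sum_i `|x i| ^+ 2).

Local Notation norm := direct_sum_norm.

Let normE x : norm x ^+ 2 = \sum_i `|x i| ^+ 2.
Proof. by rewrite sqr_sqrtr// sumr_ge0. Qed.

Let norm_ge x i : `|x i| <= norm x.
Proof.
rewrite -(@ler_pXn2r _ 2)// ?nnegrE ?sqrtr_ge0// normE (bigD1 i)//=.
by rewrite lerDl sumr_ge0.
Qed.

Let norm0_eq0 x : norm x = 0 -> x = 0.
Proof.
move=> x0; apply/functional_extensionality_dep => i.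
by apply/eqP; rewrite -normr_le0 -x0 norm_ge.
Qed.

Let normZ (a : R) x : norm (a *: x) = `|a| * norm x.
Proof.
rewrite /norm -[in RHS](sqrtr_sqr a) -sqrtrM ?sqr_ge0// mulr_sumr.
by congr Num.sqrt; apply: eq_bigr => i _; rewrite normrZ exprMn real_normK ?num_real.
Qed.

Let sum_le x y : \sum_i `|x i| * `|y i| <= norm x * norm y.
Proof.
have [x0|x0] := eqVneq (norm x) 0.
  rewrite x0 mul0r big1// => i _.
  have := norm_ge x i; rewrite x0 normr_le0 => /eqP ->.
  by rewrite normr0 mul0r.
have [y0|y0] := eqVneq (norm y) 0.
  rewrite y0 mulr0 big1// => i _.
  have := norm_ge y i; rewrite y0 normr_le0 => /eqP ->.
  by rewrite normr0 mulr0.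
have xy0 : 0 < norm x * norm y by rewrite mulr_gt0// lt0r ?x0 ?y0 sqrtr_ge0.
have : 0 <= \sum_i (norm x * `|y i| - norm y * `|x i|) ^+ 2.
  by apply: sumr_ge0 => i _; exact: sqr_ge0.
have -> : \sum_i (norm x * `|y i| - norm y * `|x i|) ^+ 2 =
    2 * (norm x * norm y) * (norm x * norm y - \sum_i `|x i| * `|y i|).
  transitivity (\sum_i (norm x ^+ 2 * `|y i| ^+ 2 + norm y ^+ 2 * `|x i| ^+ 2
      - 2 * (norm x * norm y) * (`|x i| * `|y i|))).
    by apply: eq_bigr => i _; ring.
  by rewrite sumrB big_split/= -!mulr_sumr -!normE; ring.
by rewrite pmulr_rge0 ?subr_ge0// mulr_gt0.
Qed.

Let normD x y : norm (x + y) <= norm x + norm y.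
Proof.
rewrite -(@ler_pXn2r _ 2)// ?nnegrE ?addr_ge0 ?sqrtr_ge0//.
rewrite normE sqrrD !normE -mulr_natl.
apply: (@le_trans _ _ (\sum_i (`|x i| ^+ 2 + 2 * (`|x i| * `|y i|) + `|y i| ^+ 2))).
  apply: ler_sum => i _; rewrite mulr_natl -sqrrD.
  by rewrite ler_pXn2r// ?nnegrE ?addr_ge0// ler_normD.
by rewrite !big_split/= lerD2r lerD2l -mulr_sumr ler_pM2l// sum_le.
Qed.

HB.instance Definition _ := Lmodule_isNormed.Build R T normD normZ norm0_eq0.

Let norm_le x : norm x <= \sum_i `|x i|.
Proof.
rewrite -(@ler_pXn2r _ 2)// ?nnegrE ?sqrtr_ge0// ?sumr_ge0// normE.
rewrite [leRHS]expr2 mulr_suml; apply: ler_sum => i _; rewrite expr2.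
by rewrite ler_wpM2l// (bigD1 i)//= lerDl sumr_ge0.
Qed.

Let cauchy_cvg (F : set_system T) : ProperFilter F -> cauchy F -> cvg F.
Proof.
move=> PF /cauchy_ballP cF.
have cvgi i : cvg ((fun x : T => x i) @ F).
  apply: cauchy_cvg; apply/cauchy_ballP => e e0.
  rewrite near_map2; apply: filterS (cF e e0) => -[x y] /=.
  rewrite -!ball_normE /= => xye.
  by apply: le_lt_trans xye; exact: (norm_ge (x - y)).
pose l : T := fun i => lim ((fun x : T => x i) @ F).
apply/cvg_ex; exists l; apply/cvgrPdist_lt => e e0.
pose e' := e / (#|I|.+1)%:R.
have e'0 : 0 < e' by rewrite divr_gt0.
have : \forall x \near F, forall i, `|l i - (x : T) i| < e'.
  apply: filter_forall => i.
  by have /cvgrPdist_lt/(_ _ e'0) := cvgi i.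
apply: filterS => x lx.
apply: le_lt_trans (norm_le (l - x)) _.
apply: (@le_lt_trans _ _ (\sum_(i : I) e')).
  by apply: ler_sum => i _; exact: ltW (lx i).
rewrite sumr_const -mulr_natr /e' mulrAC ltr_pdivrMr// ltr_pM2l//.
by rewrite ltr_nat.
Qed.

HB.instance Definition _ := Uniform_isComplete.Build T cauchy_cvg.

Definition direct_sum_inner x y : R := \sum_i inner (x i) (y i).

Let inner_zmodl y : zmod_morphism (direct_sum_inner ^~ y).
Proof.
move=> x x'; rewrite /direct_sum_inner -sumrB; apply: eq_bigr => i _.
exact: linearBl.
Qed.

Let inner_zmodr x : zmod_morphism (direct_sum_inner x).
Proof.
move=> y y'; rewrite /direct_sum_inner -sumrB; apply: eq_bigr => i _.
exact: linearBr.
Qed.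

Let inner_scalel y : scalable_for *%R (direct_sum_inner ^~ y).
Proof.
move=> a x; rewrite /direct_sum_inner /= mulr_sumr; apply: eq_bigr => i _.
exact: linearZl_LR.
Qed.

Let inner_scaler x : scalable_for (idfun \; *%R) (direct_sum_inner x).
Proof.
move=> a y; rewrite /direct_sum_inner /= mulr_sumr; apply: eq_bigr => i _.
exact: linearZr_LR.
Qed.

Let inner_sym x y :
  direct_sum_inner x y = (-1) ^+ false * idfun (direct_sum_inner y x).
Proof.
rewrite expr0 mul1r; apply: eq_bigr => i _.
by rewrite [LHS]hermitian_subproof expr0 mul1r.
Qed.

Let inner_norm x : direct_sum_inner x x = `|x| ^+ 2.
Proof. by rewrite [RHS]normE; apply: eq_bigr => i _; exact: inner_normE. Qed.

Let inner_gt0 x : x != 0 -> 0 < direct_sum_inner x x.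
Proof. by move=> x0; rewrite inner_norm exprn_gt0// normr_gt0. Qed.

HB.instance Definition _ := @isBilinear.Build R T T R *%R (idfun \; *%R)
  direct_sum_inner inner_zmodl inner_zmodr inner_scalel inner_scaler.
HB.instance Definition _ :=
  @isHermitianSesquilinear.Build R T false idfun direct_sum_inner inner_sym.
HB.instance Definition _ := @isDotProduct.Build R T direct_sum_inner inner_gt0.

HB.instance Definition _ :=
  hasInnerProduct.Build R T inner_norm.

End direct_sum.

Definition separable (T : topologicalType) :=
  exists2 D : set T, countable D & dense D.

(* Extended-valued convexity; for [t = 0] or [t = 1] the convention
   [0 * +oo = 0] makes the inequality trivial. *)
Definition econvex (R : realType) (V : lmodType R) (f : V -> \bar R) :=
  forall (t : R) (x y : V), 0 <= t <= 1 ->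
    (f (t *: x + (1 - t) *: y)%R <= t%:E * f x + (1 - t)%:E * f y)%E.

Definition eproper (R : realType) (T : Type) (f : T -> \bar R) :=
  (forall x, f x != -oo%E) /\ (exists x, f x != +oo%E).

Definition argmin (R : realType) (T : Type) (f : T -> \bar R) : set T :=
  [set x | forall y, (f x <= f y)%E].

(* The default value of [get] is irrelevant under the intended hypotheses, by
   strong convexity of the minimized function (resp. the Riesz theorem). *)
Definition prox_wrt (R : realType) (V : hilbertType R) (N : V -> R)
    (phi : V -> \bar R) (x : V) : V :=
  get (argmin (fun y => phi y + (2^-1 * N (y - x)%R ^+ 2)%:E)%E).

Definition prox (R : realType) (V : hilbertType R) :=
  @prox_wrt R V (fun x => `|x|).

(* [b] is the inner product with respect to which the gradient is taken. *)
Definition grad_wrt (R : realType) (V : hilbertType R) (b : V -> V -> R)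
    (f : V -> R) (x : V) : V :=
  get [set v | forall h, 'd f x h = b v h].

Definition grad (R : realType) (V : hilbertType R) (f : V -> R) : V -> V :=
  grad_wrt (@inner R V) f.

Section weighted.
Context (R : realType) (n : nat) (H : 'I_n.+1 -> hilbertType R).
Implicit Types (gam : 'I_n.+1 -> R) (x y : direct_sum H).

(* The inner product, norm and distance associated with [Gamma^{-1}], where
   [Gamma] is the diagonal operator with entries [gam i]. *)
Definition winner gam x y : R := \sum_i (gam i)^-1 * inner (x i) (y i).
Definition wnorm gam x : R := Num.sqrt (\sum_i (gam i)^-1 * `|x i| ^+ 2).
Definition wdist gam x (S : set (direct_sum H)) : R :=
  inf [set wnorm gam (x - z) | z in S].
End weighted.

Definition set_block (R : realType) (n : nat) (H : 'I_n.+1 -> hilbertType R)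
    (x : direct_sum H) (i : 'I_n.+1) (u : H i) : direct_sum H :=
  dfwith x i u.

Definition sep_sum (R : realType) (n : nat) (H : 'I_n.+1 -> hilbertType R)
    (g : forall i, H i -> \bar R) (x : direct_sum H) : \bar R :=
  (\sum_i g i (x i))%E.

(* The seed [a ord0] is one of the values, so these are genuine extrema. *)
Definition imax (R : realType) (n : nat) (a : 'I_n.+1 -> R) : R :=
  \big[Num.max/a ord0]_i a i.
Definition imin (R : realType) (n : nat) (a : 'I_n.+1 -> R) : R :=
  \big[Num.min/a ord0]_i a i.

HB.instance Definition _ n := isPointed.Build 'I_n.+1 ord0.
HB.instance Definition _ n := @isMeasurable.Build default_measure_display
  'I_n.+1 discrete_measurable discrete_measurable0
  discrete_measurableC discrete_measurableU.

Definition mutually_independent d d' (Omega : measurableType d)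
    (T : measurableType d') (R : realType) (P : probability Omega R)
    (X : nat -> {RV P >-> T}) :=
  forall (J : {fset nat}) (A : nat -> set T),
    (forall k, measurable (A k)) ->
    P (\bigcap_(k in [set` J]) X k @^-1` A k) =
    (\prod_(k <- J) P (X k @^-1` A k))%E.

Definition iid_with_law d (Omega : measurableType d) (R : realType)
    (P : probability Omega R) (n : nat) (X : nat -> {RV P >-> 'I_n.+1})
    (p : 'I_n.+1 -> R) :=
  mutually_independent X /\
  forall k i, distribution P (X k) [set i] = (p i)%:E.

(* [delay_point x d k] is the point with blocks [x_i^{k - d^k_i}]. *)
Definition delay_point (R : realType) (n : nat) (H : 'I_n.+1 -> hilbertType R)
    (x : nat -> direct_sum H) (d : nat -> 'I_n.+1 -> nat) (k : nat) :
    direct_sum H :=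
  fun i => x (k - d k i)%N i.

Definition async_fb (R : realType) (n : nat) (H : 'I_n.+1 -> hilbertType R)
    (f : direct_sum H -> R) (g : forall i, H i -> \bar R) (gam : 'I_n.+1 -> R)
    (d : nat -> 'I_n.+1 -> nat) (x0 : direct_sum H)
    (ik : nat -> 'I_n.+1) (x : nat -> direct_sum H) :=
  x 0%N = x0 /\
  forall k i, x k.+1 i =
    if i == ik k
    then prox (fun u => (gam i)%:E * g i u)%E
              (x k i - gam i *: grad f (delay_point x d k) i)
    else x k i.

Section constants.
Context (R : realType) (n : nat).
Implicit Types (L gam p : 'I_n.+1 -> R).

Definition delta_step L gam p (tau : nat) (Lres : R) : R :=
  imax (fun i => L i * gam i +
    2 * gam i * tau%:R * Lres * (imax p / Num.sqrt (imin p))).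

Definition kappa (C delta : R) : R :=
  1 + Num.max (2 * C + delta - 2) 0 / (2 - delta).

Definition theta gam p (tau : nat) (Lres delta : R) : R :=
  tau%:R * Lres * imax gam / (2 - delta) *
  (imax p ^+ 2 / Num.sqrt (imin p) + 1).
End constants.

(* Main.v *)
Require Import Defs.
From HB Require Import structures.
From mathcomp Require Import all_boot all_order all_algebra finmap ring lra.
From mathcomp Require Import all_classical all_reals all_analysis measurable_realfun.
Set Implicit Arguments.
Unset Strict Implicit.
Unset Printing Implicit Defensive.
Import Order.TTheory GRing.Theory Num.Theory.
Import numFieldNormedType.Exports.
Local Open Scope classical_set_scope.
Local Open Scope ring_scope.

(** Fix the history up to step [k]; let [x] be the current iterate, [y] the
    delayed point, [D] the forward-backward direction at [x] computed with the
    gradient at [y], and [D'] the one computed with the gradient at [x]. Two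
    inequalities on the mean of the objective over the next random block carry
    the proof.

    The first one, [expected_decrease], is a descent inequality. The proximal
    inequality compares the new block with the old one, and the error made on
    the gradient is controlled by the last [tau] displacements. The stepsize
    condition leaves a margin [eta = 1 - delta / 2] in front of the squared
    weighted norm of [D].

    The second one, [expected_gap_decrease], is a decrease proportional to the
    gap [F x - Fs]. The proximal inequality at a minimizer [z] bounds the sum of
    the block gaps by [Fs - F x], a delay error and the product of [D] with
    [z - x]; as every block gap is nonpositive, unequal probabilities only cost
    the factor [pmin]. The product is at most the norm of [D] times the distance
    from [x] to the minimizers, and the error bound replaces this distance by
    [C] times the norm of [D'], not of [D]. Estimating [D - D'] by the delay
    would produce a delay term proportional to [C], which the announced rate
    does not contain. Instead the product of the two norms is bounded by the
    mean of their squares, the square of [D'] is expanded around [D], and the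
    resulting cross term is merged with the cross term of the descent
    inequality. By firm nonexpansiveness of the proximal map, [D - D'] points in
    the direction of the gradient error, so that merging does not increase the
    cross term and even leaves a negative square that absorbs that of [D - D']:
    this is [cross_absorb].

    Adding to the expected gap a weighted sum of the last [tau] squared
    displacements gives a Lyapunov function. It decreases at every step by
    [eta] times the expected square of [D], and this decrease over [tau] steps
    pays for the delay terms of the second inequality; whence a contraction by
    [1 - pmin / (kappa + theta)] over [tau + 1] steps ([lyapunov_contraction]).

    The iterate at step [k] is a function of the first [k] drawn blocks, so
    expectations are finite sums over histories ([expect_next]). For the
    convergence of the iterates, the expected displacements are summable at the
    geometric rate; hence almost every path has finite length, its limit
    minimizes the objective by lower semicontinuity, and the remaining length of
    the path bounds the distance to the limit ([int_dist_path_limit]). *)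

(** * Inner products and proximal points *)

Section inner_product.
Context (R : realType) (V : hilbertType R).
Implicit Types u v w : V.

Lemma innerC u v : inner u v = inner v u.
Proof. by rewrite [LHS]hermitian_subproof expr0 mul1r. Qed.

Lemma innerDl u v w : inner (u + v) w = inner u w + inner v w.
Proof. exact: linearDl. Qed.

Lemma innerDr u v w : inner w (u + v) = inner w u + inner w v.
Proof. by rewrite innerC innerDl !(innerC w). Qed.

Lemma innerZl (a : R) u w : inner (a *: u) w = a * inner u w.
Proof. exact: linearZl_LR. Qed.

Lemma innerZr (a : R) u w : inner w (a *: u) = a * inner w u.
Proof. by rewrite innerC innerZl innerC. Qed.

Lemma innerNl u w : inner (- u) w = - inner u w.
Proof. by rewrite -scaleN1r innerZl mulN1r. Qed.

Lemma innerNr u w : inner w (- u) = - inner w u.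
Proof. by rewrite innerC innerNl innerC. Qed.

Definition inner_lin := (innerDl, innerDr, innerNl, innerNr, innerZl, innerZr).

Lemma inner0l w : inner 0 w = 0.
Proof. by rewrite -(scale0r 0) innerZl mul0r. Qed.

Lemma inner0r w : inner w 0 = 0.
Proof. by rewrite innerC inner0l. Qed.

Lemma sqr_normD u v : `|u + v| ^+ 2 = `|u| ^+ 2 + 2 * inner u v + `|v| ^+ 2.
Proof. rewrite -!inner_normE !inner_lin (innerC v u); ring. Qed.

Lemma sqr_normB u v : `|u - v| ^+ 2 = `|u| ^+ 2 - 2 * inner u v + `|v| ^+ 2.
Proof. by rewrite sqr_normD normrN innerNr mulrN. Qed.

Lemma le_inner_norm u v : inner u v <= `|u| * `|v|.
Proof.
have [->|v0] := eqVneq v 0; first by rewrite inner0r normr0 mulr0.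
have v1 : 0 < `|v| by rewrite normr_gt0.
have [->|u0] := eqVneq u 0; first by rewrite inner0l normr0 mul0r.
have u1 : 0 < `|u| by rewrite normr_gt0.
have : 0 <= `|(`|v|) *: u - (`|u|) *: v| ^+ 2 by exact: sqr_ge0.
rewrite sqr_normB !inner_lin !normrZ !normr_id !exprMn => h.
rewrite -(@ler_pM2l _ (2 * `|u| * `|v|)) ?mulr_gt0//.
rewrite -subr_ge0; apply: le_trans h _.
by rewrite le_eqVlt; apply/orP; left; apply/eqP; ring.
Qed.

(** Expand the square of [mu b D - (mu del - c e)]. Since [inner del e] is at
    least [`|e| ^+ 2], the vector [mu del - c e] is shorter than [mu del] by an
    amount that pays for the last term on the left. *)
Lemma cross_absorb (D del e : V) (mu c gm b : R) :
  0 < mu -> 0 <= c <= mu -> 0 < b -> gm * b <= 1 ->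
  `|e| ^+ 2 <= inner del e ->
  mu * inner D del - c * inner D e + c * gm / 2 * `|e| ^+ 2 <=
  mu * b / 2 * `|D| ^+ 2 + mu * b^-1 / 2 * `|del| ^+ 2.
Proof.
move=> mu0 /andP[c0 cmu] b0 gb firm.
rewrite -(@ler_pM2l _ (2 * mu * b)) ?mulr_gt0//.
(* The optimal Young inequality for the combined cross term. *)
have sq : 0 <= `|(mu * b) *: D - (mu *: del - c *: e)| ^+ 2 by exact: sqr_ge0.
rewrite -inner_normE !inner_lin !inner_normE in sq.
rewrite (innerC del D) (innerC e D) (innerC e del) in sq.
have -> : 2 * mu * b * (mu * b / 2 * `|D| ^+ 2 + mu * b^-1 / 2 * `|del| ^+ 2) =
    mu ^+ 2 * b ^+ 2 * `|D| ^+ 2 + mu ^+ 2 * `|del| ^+ 2.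
  by field; rewrite gt_eqF.
have ce : c * (gm * b) * (mu * `|e| ^+ 2) <= c * 1 * (mu * `|e| ^+ 2).
  by rewrite ler_wpM2r ?mulr_ge0 ?sqr_ge0 ?(ltW mu0)// ler_wpM2l.
have cc : c * c * `|e| ^+ 2 <= c * mu * `|e| ^+ 2.
  by rewrite ler_wpM2r ?sqr_ge0// ler_wpM2l.
have ci : c * mu * `|e| ^+ 2 <= c * mu * inner del e.
  by rewrite ler_wpM2l// mulr_ge0// ltW.
lra.
Qed.

End inner_product.

Section prox.
Context (R : realType) (V : hilbertType R) (phi : V -> \bar R).
Hypotheses (phi_proper : eproper phi) (phi_convex : econvex phi)
  (phi_lsc : lower_semicontinuous phi).

(** Lower semicontinuity bounds [phi] below near a point of its domain, and
    convexity spreads this bound over the whole space, with an affine loss. *)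
Lemma econvex_minorant :
  exists A c : R, 0 <= c /\ forall y, ((A - c * `|y|)%:E <= phi y)%E.
Proof.
case: phi_proper => phiN [x0 phix0].
have [r r0] : exists r, phi x0 = r%:E.
  by case: (phi x0) (phiN x0) phix0 => // r; exists r.
have r1 : ((r - 1)%:E < phi x0)%E by rewrite r0 lte_fin ltrBlDr ltrDl.
have [W /nbhs_ballP[e /= e0 eW] Wr] := phi_lsc r1.
exists (r - 2 - 2 * `|x0| / e), (2 / e); split; first by rewrite divr_ge0// ltW.
move=> y; case E : (phi y) (phiN y) => [s| |]//; last by rewrite leey.
move=> _.
have y0 : 0 < `|y - x0| + e by rewrite ltr_wpDl.
pose t := e / (2 * (`|y - x0| + e)).
have t0 : 0 < t by rewrite divr_gt0// mulr_gt0.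
have t1 : t <= 1.
  rewrite ler_pdivrMr ?mulr_gt0// mul1r mulrDr.
  by have := normr_ge0 (y - x0); lra.
have : (phi (t *: y + (1 - t) *: x0)%R <= (t * s + (1 - t) * r)%:E)%E.
  by apply: le_trans (phi_convex _ _ _) _; rewrite ?(ltW t0)// E r0.
move=> /(lt_le_trans (Wr _ _)); rewrite lte_fin => h.
have {}h : r - 1 < t * s + (1 - t) * r.
  apply: h; apply: eW; rewrite -ball_normE /=.
  have -> : x0 - (t *: y + (1 - t) *: x0) = t *: (x0 - y).
    by rewrite scalerBl scale1r scalerBr opprD opprB addrCA (addrC x0) subrK addrC.
  rewrite normrZ gtr0_norm// distrC /t mulrAC ltr_pdivrMr ?mulr_gt0//.
  by rewrite ltr_pM2l//; have := normr_ge0 (y - x0); lra.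
have {}h : r - t^-1 < s.
  by rewrite -(ltr_pM2l t0) mulrBr divff ?gt_eqF//; lra.
rewrite lee_fin (le_trans _ (ltW h))// /t invf_div.
have := ler_normB y x0; rewrite -(ler_pM2l (_ : 0 < 2 / e)) ?divr_gt0// => hn.
have -> : 2 * (`|y - x0| + e) / e = 2 / e * `|y - x0| + 2.
  by field; rewrite gt_eqF.
by move: hn; rewrite mulrDr; lra.
Qed.

(** [J] is the function that the proximal point of [phi] at [x] minimizes. *)
Variable x : V.
Let J y : \bar R := (phi y + (2^-1 * `|y - x| ^+ 2)%:E)%E.

Lemma mid_sqr_norm (y z : V) : `|2^-1 *: y + (1 - 2^-1) *: z - x| ^+ 2 =
  2^-1 * `|y - x| ^+ 2 + 2^-1 * `|z - x| ^+ 2 - 4^-1 * `|y - z| ^+ 2.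
Proof.
have h2 : 1 - 2^-1 = 2^-1 :> R by field.
have -> : 2^-1 *: y + (1 - 2^-1) *: z - x = 2^-1 *: ((y - x) + (z - x)).
  have xx : x = 2^-1 *: x + 2^-1 *: x.
    by rewrite -scalerDl (_ : 2^-1 + 2^-1 = 1) ?scale1r//; field.
  by rewrite h2 [in LHS]xx !scalerDr opprD !scalerN addrACA.
have -> : y - z = (y - x) - (z - x) by rewrite opprB addrA subrK.
move: (y - x) (z - x) => u v.
by rewrite normrZ exprMn sqr_normB sqr_normD ger0_norm ?invr_ge0//; field.
Qed.

(** A minimizing sequence of the strongly convex function [J] is Cauchy, by the
    parallelogram identity. *)
Lemma prox_exists : exists y, argmin J y.
Proof.
have [A [c [c0 minor]]] := econvex_minorant.
have [phiN [x0 phix0]] := phi_proper.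
pose S := [set r : R | exists y, (J y <= r%:E)%E].
have S0 : S !=set0.
  case E : (phi x0) (phiN x0) phix0 => [r| |]// _ _.
  by exists (r + 2^-1 * `|x0 - x| ^+ 2); exists x0; rewrite /J E.
have lbS : has_lbound S.
  exists (A - c * `|x| - 2^-1 * c ^+ 2) => r [y].
  case E : (phi y) (phiN y) => [s| |]//; last by rewrite /J E.
  move=> _; rewrite /J E lee_fin => /(le_trans _); apply.
  have := minor y; rewrite E lee_fin => h.
  have : 0 <= (`|y - x| - c) ^+ 2 by exact: sqr_ge0.
  have {}h' : c * `|y| <= c * (`|y - x| + `|x|).
    by apply: ler_wpM2l => //; rewrite -{1}(subrK x y) ler_normD.
  by rewrite mulrDr in h'; rewrite sqrrB; lra.
have infS : has_inf S by split.
pose m := inf S.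
have mJ y : (m%:E <= J y)%E.
  rewrite /J; case E : (phi y) (phiN y) => [s| |]// _.
    by rewrite lee_fin; apply: ge_inf => //; exists y; rewrite /J E.
  by rewrite addye// leey.
have /choice[u uJ] : forall n : nat, exists y, (J y <= (m + n.+1%:R^-1)%:E)%E.
  move=> n; have n0 : (0 : R) < n.+1%:R^-1 by rewrite invr_gt0.
  have [r [y yr] rm] := inf_adherent n0 infS.
  by exists y; rewrite (le_trans yr)// lee_fin ltW.
have uu i j : `|u i - u j| ^+ 2 <= 4 * (i.+1%:R^-1 + j.+1%:R^-1).
  have := uJ i; have := uJ j; rewrite /J.
  case Ei : (phi (u i)) (phiN (u i)) => [si| |]// _;
    case Ej : (phi (u j)) (phiN (u j)) => [sj| |]// _.
  rewrite !lee_fin => hj hi.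
  have h01 : 0 <= (2^-1 : R) <= 1 by apply/andP; split; lra.
  have := phi_convex (u i) (u j) h01; rewrite Ei Ej.
  have := mJ (2^-1 *: u i + (1 - 2^-1) *: u j); rewrite /J mid_sqr_norm.
  case: (phi _) => [s| |]//.
  rewrite -!EFinM -!EFinD !lee_fin; 
  by move: hi hj; move: (i.+1%:R^-1) (j.+1%:R^-1) => a b hi hj; lra.
have cu : cvgn u.
  apply/cauchy_cvgP/cauchy_exP => e e0.
  have e20 : 0 < e ^+ 2 / 8 by rewrite divr_gt0// exprn_gt0.
  have [N _ hN] := near_infty_natSinv_lt (PosNum e20).
  exists (u N); exists N => // k /= Nk; rewrite -ball_normE /=.
  rewrite -(@ltr_pXn2r _ 2)// ?nnegrE ?(ltW e0)//.
  apply: le_lt_trans (uu N k) _.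
  have /= := hN N (leqnn N); have /= := hN k Nk.
  by move: (k.+1%:R^-1) (N.+1%:R^-1) => a b; lra.
pose y := limn u; exists y.
suff ym : (J y <= m%:E)%E by move=> z; apply: le_trans ym (mJ z).
rewrite leNgt; apply/negP => mlt.
(* Were [J y] above [m], lower semicontinuity of [phi] at [y] would keep [J (u n)]
   above a level larger than [m]. *)
have [a [aphi am]] : exists a : R, (a%:E < phi y)%E /\ m < a + 2^-1 * `|y - x| ^+ 2.
  move: mlt; rewrite /J; case E : (phi y) (phiN y) => [s| |]// _ h.
    exists ((s + (m - 2^-1 * `|y - x| ^+ 2)) / 2); move: h.
    by rewrite !lte_fin => h; split; lra.
  by exists (m - 2^-1 * `|y - x| ^+ 2 + 1); rewrite ltry; split=> //; lra.
have [W Wy Wa] := phi_lsc aphi.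
have cN : (m + n.+1%:R^-1 - (a + 2^-1 * `|u n - x| ^+ 2)) @[n --> \oo] -->
    m + 0 - (a + 2^-1 * `|y - x| ^+ 2).
  apply: cvgB; first by apply: cvgD; [exact: cvg_cst|exact: cvg_harmonic].
  apply: cvgD; first exact: cvg_cst.
  apply: cvgZr; rewrite expr2; under eq_fun do rewrite expr2.
  have h : `|u n - x| @[n --> \oo] --> `|y - x|.
    by apply: cvg_norm; apply: cvgB => //; exact: cvg_cst.
  exact: cvgM.
have : 0 <= m + 0 - (a + 2^-1 * `|y - x| ^+ 2).
  rewrite -(cvg_lim _ cN)//; apply: limr_ge; first by apply/cvg_ex; eexists; exact: cN.
  have : \forall n \near \oo, W (u n) by exact: cu Wy.
  apply: filterS => n /Wa; have := uJ n; rewrite /J.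
  case: (phi (u n)) => [s| |]//; rewrite !lee_fin lte_fin.
  by move: (n.+1%:R^-1) => b; lra.
by rewrite addr0; lra.
Qed.

Let p := prox phi x.

Lemma prox_argmin : argmin J p.
Proof. by rewrite /p /prox /prox_wrt; apply: getPex; exact: prox_exists. Qed.

Lemma prox_fin_num : phi p \is a fin_num.
Proof.
have [phiN [x0 phix0]] := phi_proper.
have := prox_argmin x0; rewrite /J fin_numE phiN /=.
case: (phi x0) (phiN x0) phix0 => [s| |]// _ _.
by case: (phi p) => [r| |].
Qed.

(** First-order optimality: compare [p] with the points of the segment from [p]
    to [y] close to [p]. *)
Lemma prox_variational y : (phi p + (inner (x - p) (y - p))%:E <= phi y)%E.
Proof.
have [phiN _] := phi_proper.
case Ep : (phi p) prox_fin_num => [r| |]// _.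
case Ey : (phi y) (phiN y) => [s| |]// _; last by rewrite leey.
rewrite -EFinD lee_fin.
have key t : 0 < t <= 1 -> r + inner (x - p) (y - p) <= s + t * `|y - p| ^+ 2.
  move=> /andP[t0 t1]; have t01 : 0 <= t <= 1 by rewrite ltW.
  have := prox_argmin (t *: y + (1 - t) *: p).
  have := phi_convex y p t01; rewrite /J Ep Ey.
  case: (phi (_ + _)) => [q| |]//; rewrite -!EFinM -!EFinD !lee_fin.
  have -> : t *: y + (1 - t) *: p - x = (p - x) + t *: (y - p).
    by rewrite scalerBl scale1r scalerBr addrCA addrAC.
  rewrite (sqr_normD (p - x)) innerZr normrZ exprMn (gtr0_norm t0).
  have -> : inner (p - x) (y - p) = - inner (x - p) (y - p).
    by rewrite -innerNl opprB.
  move=> h1 h2; rewrite -(ler_pM2l t0).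
  have := sqr_ge0 (`|y - p|); have := sqr_ge0 t; nra.
rewrite leNgt; apply/negP => h.
set D := `|y - p| ^+ 2 in key; have D0 : 0 <= D by exact: sqr_ge0.
pose g := r + inner (x - p) (y - p) - s.
have g0 : 0 < g by rewrite /g; lra.
pose t := g / (D + g + 1).
have B0 : 0 < D + g + 1 by lra.
have : t * D < g.
  by rewrite /t mulrAC ltr_pdivrMr// ltr_pM2l//; lra.
have := key t; rewrite /t divr_gt0//= ler_pdivrMr// mul1r => /(_ _).
by move=> /(_ ltac:(lra)); rewrite /g; lra.
Qed.

End prox.

(** * Smooth functions on a Hilbert space *)

Section smooth.
Context (R : realType) (V : hilbertType R).

(** Riesz representation: the proximal point of [- l] at the origin minimizes
    [2^-1 * `|v| ^+ 2 - l v], and its optimality condition represents [l]. *)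
Lemma riesz (l : {linear V -> R}) : continuous l ->
  exists v, forall h, l h = inner v h.
Proof.
move=> cl; pose phi (y : V) : \bar R := (- l y)%:E.
have phi_proper : eproper phi by split=> //; exists 0.
have phi_convex : econvex phi.
  move=> t x y _; rewrite /phi -!EFinM -EFinD lee_fin linearD !linearZ /=.
  by rewrite le_eqVlt; apply/orP; left; apply/eqP; rewrite /GRing.scale /=; ring.
have phi_lsc : lower_semicontinuous phi.
  move=> x a; rewrite lte_fin => ax.
  exists [set y | a < - l y]; last by move=> y /=; rewrite lte_fin.
  have cx : - l y @[y --> x] --> - l x by apply: cvgN; exact: cl.
  exact: cx (lt_nbhsr ax).
pose p := prox phi 0; exists p.
have le h : l h <= inner p h.
  have := prox_variational phi_proper phi_convex phi_lsc 0 (p + h).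
  by rewrite -/p /phi lee_fin sub0r (addrC p) addrK innerNl linearD /=; lra.
move=> h; apply/eqP; rewrite eq_le le/=.
by have := le (- h); rewrite linearN innerNr lerN2.
Qed.

Lemma grad_spec (f : V -> R) x h : differentiable f x ->
  'd f x h = inner (grad f x) h.
Proof.
move=> df; have [v hv] : exists v, forall h, 'd f x h = inner v h.
  by apply: riesz; exact: diff_continuous.
rewrite /grad /grad_wrt; move: h.
exact: (@getPex _ [set v | forall h, 'd f x h = inner v h] (ex_intro _ v hv)).
Qed.

Variable f : V -> R.
Hypothesis f_diff : forall x, differentiable f x.

Lemma is_derive_line x h (t : R) :
  is_derive t 1 (fun t : R => f (x + t *: h)) (inner (grad f (x + t *: h)) h).
Proof.
have E : (fun s : R => s^-1 *: (((fun t : R => f (x + t *: h)) \o shift t) (s *: 1)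
    - f (x + t *: h))) =
  (fun s : R => s^-1 *: ((f \o shift (x + t *: h)) (s *: h) - f (x + t *: h))).
  apply/funext => s /=; congr (_ *: (f _ - _)).
  have -> : s *: (1 : R) = s by exact: mulr1.
  by rewrite scalerDl addrCA.
have df : derivable f (x + t *: h) h by exact: diff_derivable.
split; first by rewrite /derivable E.
by rewrite /derive E -[LHS]/('D_h f (x + t *: h)) deriveE// grad_spec.
Qed.

(** Along the segment, [f] minus the parabola on the right has a nonpositive
    derivative. *)
Lemma descent x h (M : R) :
  (forall t, 0 < t < 1 -> inner (grad f (x + t *: h) - grad f x) h <= M * t) ->
  f (x + h) <= f x + inner (grad f x) h + M / 2.
Proof.
move=> hM; have dline := is_derive_line x h.
move: (grad f) hM dline => G hM dline; pose c := inner (G x) h.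
pose q (t : R) : R := f (x + t *: h) - (c * t + M / 2 * t ^+ 2).
have dq (t : R) : is_derive t 1 q (inner (G (x + t *: h)) h - (c + M * t)).
  have d1 := dline t.
  have d2 : is_derive t 1 (fun t : R => c * t + M / 2 * t ^+ 2) (c + M * t).
    by apply: is_derive_eq; rewrite /GRing.scale /=; field.
  exact: (is_deriveB d1 d2).
have : q 1 <= q 0.
  apply: (@ler0_derive1_le_cc _ q 0 1); rewrite ?in_itv/= ?lexx ?ler01//.
  - move=> t; rewrite in_itv/= => t01; rewrite derive1E derive_val.
    by have := hM t t01; rewrite innerDl innerNl -/c; lra.
  - apply: continuous_subspaceT => t; apply: differentiable_continuous.
    by apply/derivable1_diffP.
by rewrite /q scale1r scale0r addr0 -/c; lra.
Qed.

Hypothesis f_convex : convex_function [set: convex_lmodType V] f.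

Lemma grad_convex x y : f x + inner (grad f x) (y - x) <= f y.
Proof.
pose h := y - x.
have cv t : 0 < t <= 1 -> t^-1 * (f (x + t *: h) - f x) <= f y - f x.
  move=> /andP[t0 t1].
  have := @f_convex (Itv01 (ltW t0) t1) y x (in_setT _) (in_setT _).
  rewrite convRE /=.
  have -> : conv (Itv01 (ltW t0) t1) (y : convex_lmodType V) x = x + t *: h.
    transitivity (t *: y + (1 - t) *: x) => //.
    by rewrite scalerBl scale1r /h scalerBr addrCA.
  by rewrite /unstable.onem ler_pdivrMl// => ?; lra.
have := is_derive_line x h 0; rewrite scale0r addr0 => -[dl vl].
rewrite leNgt; apply/negP => lt.
have {}lt : f y - f x < 'D_1 (fun t : R => f (x + t *: h)) 0.
  by rewrite vl -/h in lt *; lra.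
have := cvgr_gt _ dl _ lt; rewrite /= scale0r addr0.
move=> [e /= e0 he].
(* The difference quotients of a convex function along [h] on ]0, 1] are below
   [f y - f x], so their limit at 0 cannot exceed it. *)
pose t := Num.min (e / 2) 1.
have t0 : 0 < t by rewrite lt_min ltr01 divr_gt0.
have t1 : t <= 1 by rewrite ge_min lexx orbT.
have := he t; rewrite /ball_ /= sub0r normrN gtr0_norm// gt_eqF//.
have te : t < e by rewrite gt_min; apply/orP; left; lra.
move=> /(_ te isT); rewrite /= /GRing.scale /= mulr1 addr0 => h2.
by have := cv t; rewrite t0 t1 => /(_ isT); lra.
Qed.

End smooth.

Section scaled_prox.
Context (R : realType) (V : hilbertType R) (g : V -> \bar R) (c : R).
Hypotheses (g_proper : eproper g) (g_convex : econvex g)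
  (g_lsc : lower_semicontinuous g) (c_gt0 : 0 < c).
Let phi u : \bar R := (c%:E * g u)%E.

Let phi_proper : eproper phi.
Proof.
have [gN [x0 gx0]] := g_proper; split=> [x|].
  by rewrite /phi; case: (g x) (gN x) => [r| |]//; rewrite gt0_muley.
exists x0; rewrite /phi.
by case: (g x0) (gN x0) gx0.
Qed.

Let phi_convex : econvex phi.
Proof.
move=> t x y t01; have /andP[t0 t1] := t01; rewrite /phi.
have := g_convex x y t01; rewrite -(@lee_pmul2l _ c%:E)// => /le_trans; apply.
have [gN _] := g_proper.
rewrite muleDr//; first by rewrite !muleA (muleC c%:E) (muleC c%:E).
have h (s : R) z : 0 <= s -> (s%:E * g z != -oo)%E.
  rewrite le_eqVlt => /orP[/eqP<-|s0]; first by rewrite mul0e.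
  by case: (g z) (gN z) => [r| |]//; rewrite gt0_muley.
have := h t x t0; have := h (1 - t) y (ltac:(by rewrite subr_ge0)).
by rewrite /adde_def; case: (_ * g x)%E => [?| |]; case: (_ * g y)%E => [?| |].
Qed.

Let phi_lsc : lower_semicontinuous phi.
Proof.
move=> x a; rewrite /phi => ax.
have [|W Wx Wa] := @g_lsc x (c^-1 * a).
  by rewrite -(@lte_pmul2l _ c%:E)// -EFinM mulrA divff ?gt_eqF// mul1r.
exists W => // y /Wa.
by rewrite -(@lte_pmul2l _ c%:E)// -EFinM mulrA divff ?gt_eqF// mul1r.
Qed.

Lemma scaled_prox_fin_num x : g (prox phi x) \is a fin_num.
Proof.
have := prox_fin_num phi_proper phi_convex phi_lsc x; rewrite {1}/phi.
have [gN _] := g_proper.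
by case: (g _) (gN (prox phi x)) => [r| |]//; rewrite gt0_muley.
Qed.

Lemma scaled_prox_variational x y :
  (g (prox phi x) + (c^-1 * inner (x - prox phi x) (y - prox phi x))%:E <= g y)%E.
Proof.
have := prox_variational phi_proper phi_convex phi_lsc x y.
have := scaled_prox_fin_num x; move: (prox phi x) => p; rewrite {1 2}/phi.
have [gN _] := g_proper.
case: (g p) => [r| |]// _; case: (g y) (gN y) => [s| |]// _; last by rewrite leey.
rewrite -!EFinM -!EFinD !lee_fin => h.
rewrite -(ler_pM2l c_gt0) mulrDr mulrA divff ?gt_eqF// mul1r.
exact: h.
Qed.

End scaled_prox.

(** * Direct sums and their weighted geometry *)

Section direct_sum_inner.
Context (R : realType) (n : nat) (H : 'I_n.+1 -> hilbertType R).
Implicit Types x y : direct_sum H.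

Lemma inner_direct_sum x y : inner x y = \sum_i inner (x i) (y i).
Proof. by []. Qed.

Lemma sqr_norm_direct_sum x : `|x| ^+ 2 = \sum_i `|x i| ^+ 2.
Proof. by rewrite -inner_normE inner_direct_sum; apply: eq_bigr => i _; rewrite inner_normE. Qed.

Lemma norm_coord_le x i : `|x i| <= `|x|.
Proof.
rewrite -(@ler_pXn2r _ 2)// ?nnegrE// sqr_norm_direct_sum (bigD1 i)//=.
by rewrite lerDl sumr_ge0.
Qed.

Lemma norm_le_sum_coord x : `|x| <= \sum_i `|x i|.
Proof.
rewrite -(@ler_pXn2r _ 2)// ?nnegrE ?sumr_ge0// sqr_norm_direct_sum.
rewrite [leRHS]expr2 mulr_suml; apply: ler_sum => i _; rewrite expr2.
by rewrite ler_wpM2l// (bigD1 i)//= lerDl sumr_ge0.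
Qed.

Lemma set_blockE x i (u : H i) : set_block x u i = u.
Proof. exact: dfwithin. Qed.

Lemma set_block_neq x i (u : H i) j : j != i -> set_block x u j = x j.
Proof. by move=> ji; apply: dfwithout; rewrite eq_sym. Qed.

Lemma set_block_id x i : set_block x (x i) = x.
Proof.
apply/functional_extensionality_dep => j.
by have [->|ji] := eqVneq j i; rewrite ?set_blockE// set_block_neq.
Qed.

Lemma set_blockD x i (t : R) (u : H i) :
  x + t *: (set_block 0 u) = set_block x (x i + t *: u).
Proof.
apply/functional_extensionality_dep => j.
rewrite -[LHS]/(x j + t *: set_block 0 u j).
have [->|ji] := eqVneq j i; first by rewrite !set_blockE.
by rewrite !set_block_neq// scaler0 addr0.
Qed.

Lemma inner_set_block x i (u : H i) : inner x (set_block 0 u) = inner (x i) u.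
Proof.
rewrite inner_direct_sum (bigD1 i)//= set_blockE big1 ?addr0// => j ji.
by rewrite set_block_neq// inner0r.
Qed.

End direct_sum_inner.

Section weighted_geometry.
Context (R : realType) (n : nat) (H : 'I_n.+1 -> hilbertType R).
Context (gam : 'I_n.+1 -> R) (gam_gt0 : forall i, 0 < gam i).
Implicit Types x y : direct_sum H.

Lemma sqr_wnorm x : wnorm gam x ^+ 2 = \sum_i (gam i)^-1 * `|x i| ^+ 2.
Proof.
by rewrite sqr_sqrtr// sumr_ge0// => i _; rewrite mulr_ge0 ?sqr_ge0// invr_ge0 ltW.
Qed.

Lemma wnorm_ge0 x : 0 <= wnorm gam x.
Proof. exact: sqrtr_ge0. Qed.

Lemma wnormN x : wnorm gam (- x) = wnorm gam x.
Proof.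
by rewrite /wnorm; congr Num.sqrt; apply: eq_bigr => i _; rewrite normrN.
Qed.

(** Cauchy-Schwarz in the original inner product, for the vectors rescaled by
    the square roots of the weights. *)
Lemma le_winner_wnorm x y : winner gam x y <= wnorm gam x * wnorm gam y.
Proof.
pose w i := Num.sqrt (gam i)^-1.
have wE i : w i ^+ 2 = (gam i)^-1 by rewrite sqr_sqrtr// invr_ge0 ltW.
pose X : direct_sum H := fun i => w i *: x i.
pose Y : direct_sum H := fun i => w i *: y i.
have -> : winner gam x y = inner X Y.
  by rewrite inner_direct_sum; apply: eq_bigr => i _; rewrite !inner_lin mulrA -expr2 wE.
suff E (z : direct_sum H) : wnorm gam z = `|(fun i => w i *: z i) : direct_sum H|.
  by rewrite !E le_inner_norm.
apply/eqP; rewrite -(@eqrXn2 _ 2)// ?wnorm_ge0//; apply/eqP.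
rewrite sqr_wnorm sqr_norm_direct_sum; apply: eq_bigr => i _.
by rewrite normrZ exprMn ger0_norm ?sqrtr_ge0// wE.
Qed.

(** The distance is an infimum that need not be attained for an arbitrary [S],
    so bounds by the distance are derived from bounds at every point of [S]. *)
Lemma ge_wdist x (S : set (direct_sum H)) (A d : R) :
  S !=set0 -> 0 <= d -> (forall z, S z -> A <= d * wnorm gam (x - z)) ->
  A <= d * wdist gam x S.
Proof.
move=> [z0 Sz0]; rewrite le_eqVlt => /orP[/eqP<-|d0] Ad.
  by rewrite mul0r; have := Ad _ Sz0; rewrite mul0r.
rewrite mulrC -ler_pdivrMr//; apply: lb_le_inf; first by exists (wnorm gam (x - z0)), z0.
by move=> _ [z Sz <-]; rewrite ler_pdivrMr// mulrC Ad.
Qed.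

Lemma grad_wrt_winner (f : direct_sum H -> R) x : differentiable f x ->
  grad_wrt (winner gam) f x = fun i => gam i *: grad f x i.
Proof.
move=> dfx; have E v : (forall h, winner gam v h = inner (grad f x) h) ->
    v = fun i => gam i *: grad f x i.
  move=> vE; apply/functional_extensionality_dep => i.
  apply/eqP; rewrite -subr_eq0 -normr_eq0 -sqrf_eq0 -inner_normE.
  set u := v i - _; have := vE (set_block 0 u).
  rewrite inner_set_block /winner (bigD1 i)//= set_blockE big1 ?addr0; last first.
    by move=> j ji; rewrite set_block_neq// inner0r mulr0.
  move=> vi; rewrite {1}/u innerDl innerNl innerZl -vi.
  by rewrite (mulVKf (lt0r_neq0 (gam_gt0 i))) subrr.
apply: E => h; rewrite -grad_spec//; move: h; rewrite /grad_wrt.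
have ex : exists v, forall h, 'd f x h = winner gam v h.
  exists (fun i => gam i *: grad f x i) => h.
  rewrite grad_spec// inner_direct_sum; apply: eq_bigr => i _.
  by rewrite innerZl mulrA mulVf ?gt_eqF// mul1r.
by move=> h; rewrite -(@getPex _ [set v | forall h, 'd f x h = winner gam v h] ex).
Qed.

End weighted_geometry.

(** * Block proximal maps and block Lipschitz gradients *)

Section block_prox.
Context (R : realType) (n : nat) (H : 'I_n.+1 -> hilbertType R).
Context (g : forall i, H i -> \bar R) (gam : 'I_n.+1 -> R).
Arguments g : clear implicits.
Hypotheses (g_proper : forall i, eproper (g i)) (g_convex : forall i, econvex (g i))
  (g_lsc : forall i, lower_semicontinuous (g i)) (gam_gt0 : forall i, 0 < gam i).
Implicit Types x y z : direct_sum H.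

Definition block_prox i (u : H i) : H i :=
  prox (fun v => (gam i)%:E * g i v)%E u.

Definition in_dom x := forall i, g i (x i) \is a fin_num.

Definition sep_sumr x : R := \sum_i fine (g i (x i)).

Lemma sep_sum_fin x : in_dom x -> sep_sum g x = (sep_sumr x)%:E.
Proof.
by move=> gx; rewrite /sep_sum /sep_sumr -sumEFin; apply: eq_bigr => i _; rewrite fineK.
Qed.

Lemma sep_sum_neqNy x : sep_sum g x != -oo%E.
Proof.
rewrite /sep_sum esum_eqNy; apply/existsPn => i.
by have [gN _] := g_proper i; rewrite gN.
Qed.

Lemma sep_sum_dom x : (sep_sum g x < +oo)%E -> in_dom x.
Proof.
move=> gx i; have [gN _] := g_proper i; rewrite fin_numE gN /=.
apply: contraTN gx => /eqP gi.
rewrite -leNgt leye_eq esum_eqy; first by apply/existsP; exists i; rewrite gi eqxx.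
by move=> j _; have [gNj _] := g_proper j; rewrite gNj.
Qed.

Lemma block_prox_fin_num i (u : H i) : g i (block_prox u) \is a fin_num.
Proof. exact: scaled_prox_fin_num. Qed.

Lemma block_prox_variational i (u y : H i) : g i y \is a fin_num ->
  fine (g i (block_prox u)) + (gam i)^-1 * inner (u - block_prox u) (y - block_prox u)
    <= fine (g i y).
Proof.
move=> gy; have := scaled_prox_variational (@g_proper i) (@g_convex i)
  (@g_lsc i) (gam_gt0 i) u y.
rewrite -/(block_prox u) -(fineK gy) -(fineK (block_prox_fin_num u)).
by rewrite -EFinD lee_fin.
Qed.

(** Add the variational inequalities of the two proximal points, each tested at
    the other one. *)
Lemma block_prox_firm i (u v : H i) :
  `|block_prox u - block_prox v| ^+ 2 <= inner (block_prox u - block_prox v) (u - v).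
Proof.
have := block_prox_variational u (block_prox_fin_num v).
have := block_prox_variational v (block_prox_fin_num u).
move: (fine (g i (block_prox u))) (fine (g i (block_prox v))) => s t.
move: (block_prox u) (block_prox v) => p q h1 h2.
have : (gam i)^-1 * (inner (v - q) (p - q) + inner (u - p) (q - p)) <= 0 by lra.
rewrite pmulr_rle0 ?invr_gt0// -inner_normE !inner_lin => h.
rewrite (innerC p u) (innerC p v) (innerC q u) (innerC q v) (innerC q p) in h *.
lra.
Qed.

(** The weighted proximal problem splits over the blocks; its minimizer is
    unique by strong convexity. *)
Lemma prox_wrt_wnorm z :
  prox_wrt (wnorm gam) (sep_sum g) z = fun i => block_prox (z i).
Proof.
pose P : direct_sum H := fun i => block_prox (z i).
have domP : in_dom P by move=> i; exact: block_prox_fin_num.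
have sqrB (y : direct_sum H) : wnorm gam (y - z) ^+ 2 = wnorm gam (P - z) ^+ 2
    - 2 * (\sum_i (gam i)^-1 * inner (z i - P i) (y i - P i)) + wnorm gam (y - P) ^+ 2.
  rewrite !sqr_wnorm// mulr_sumr -sumrB -big_split; apply: eq_bigr => i _ /=.
  rewrite -[(y - z) i]/(y i - z i) -[(P - z) i]/(P i - z i) -[(y - P) i]/(y i - P i).
  have -> : y i - z i = (P i - z i) + (y i - P i) by rewrite [RHS]addrC addrA subrK.
  rewrite (sqr_normD (P i - z i)) -(opprB (P i) (z i)) innerNl; ring.
have le y : in_dom y -> sep_sumr P + 2^-1 * wnorm gam (P - z) ^+ 2
    + 2^-1 * wnorm gam (y - P) ^+ 2 <= sep_sumr y + 2^-1 * wnorm gam (y - z) ^+ 2.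
  move=> gy; rewrite (sqrB y).
  suff : sep_sumr P + (\sum_i (gam i)^-1 * inner (z i - P i) (y i - P i)) <= sep_sumr y by lra.
  rewrite /sep_sumr -big_split; apply: ler_sum => i _ /=.
  exact: block_prox_variational.
pose J (y : direct_sum H) := (sep_sum g y + (2^-1 * wnorm gam (y - z)%R ^+ 2)%:E)%E.
have dom_lt (y : direct_sum H) : (J y < +oo)%E -> in_dom y.
  move=> h; apply: sep_sum_dom; move: h; rewrite /J.
  by case: (sep_sum g y) (sep_sum_neqNy y) => [r _ _| |]//; rewrite ltry.
have minP : argmin J P.
  move=> y; have [Jy|] := ltP (J y) +oo%E; last by rewrite leye_eq => /eqP ->; rewrite leey.
  have domy := dom_lt y Jy.
  rewrite /J !sep_sum_fin// -!EFinD lee_fin; apply: le_trans (le y domy).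
  by rewrite lerDl mulr_ge0// sqr_ge0.
have := @getPex _ (argmin J) (ex_intro _ P minP).
rewrite /prox_wrt -/J; set q := get _ => qmin.
have domq : in_dom q.
  apply: dom_lt; apply: le_lt_trans (qmin P) _.
  by rewrite /J sep_sum_fin// ltry.
have := le_trans (le q domq) (_ : _ <= sep_sumr P + 2^-1 * wnorm gam (P - z) ^+ 2).
have := qmin P; rewrite {1 2}/J !sep_sum_fin// -!EFinD lee_fin => h /(_ h) h2.
have : \sum_i (gam i)^-1 * `|(q - P) i| ^+ 2 = 0.
  apply/eqP; rewrite -sqr_wnorm// eq_le sqr_ge0 andbT; lra.
move=> /eqP; rewrite psumr_eq0; last first.
  by move=> i _; rewrite mulr_ge0 ?sqr_ge0// invr_ge0 ltW.
move=> /allP q0; apply/functional_extensionality_dep => i.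
have := q0 i (mem_index_enum i); rewrite /= mulf_eq0 invr_eq0.
by rewrite (gt_eqF (gam_gt0 i)) /= sqrf_eq0 normr_eq0 subr_eq0 => /eqP.
Qed.

End block_prox.

Section block_lipschitz.
Context (R : realType) (n : nat) (H : 'I_n.+1 -> hilbertType R).
Context (f : direct_sum H -> R) (f_diff : forall x : direct_sum H, differentiable f x).
Context (Lres : R) (L : 'I_n.+1 -> R).
Hypothesis grad_lip : forall (x : direct_sum H) i,
  Lres.-lipschitz (fun u : H i => grad f (set_block x u)).
Hypothesis grad_block_lip : forall (x : direct_sum H) i,
  (L i).-lipschitz (fun u : H i => grad f (set_block x u) i).
Implicit Types x y : direct_sum H.

(** Each of the single-block moves that lead from [y] to [x] is controlled by [Lres];
    the sum of norms, rather than the norm of [x - y], is what the chain gives. *)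
Lemma grad_dist x y : `|grad f x - grad f y| <= Lres * \sum_i `|x i - y i|.
Proof.
pose w (k : nat) : direct_sum H := fun i => if (i < k)%N then x i else y i.
have w0 : w 0 = y by [].
have wn : w n.+1 = x.
  by apply/functional_extensionality_dep => i; rewrite /w ltn_ord.
have wS (i : 'I_n.+1) : w i.+1 = set_block (w i) (x i).
  apply/functional_extensionality_dep => j.
  have [->|ji] := eqVneq j i; first by rewrite set_blockE /w ltnS leqnn.
  by rewrite set_block_neq// /w ltnS leq_eqVlt (negPf ji : (j == i :> nat) = false).
have step (i : 'I_n.+1) : `|grad f (w i.+1) - grad f (w i)| <= Lres * `|x i - y i|.
  have wi : w i = set_block (w i) (y i).
    have wii : w i i = y i by rewrite /w ltnn.
    by rewrite -wii set_block_id.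
  by rewrite wS {2}wi; exact: (@grad_lip (w i) i (x i, y i) (conj I I)).
rewrite -wn -{1}w0 -(telescope_sumr (fun k => grad f (w k)) (leq0n n.+1)).
rewrite big_mkord; apply: le_trans (ler_norm_sum _ _ _) _.
by rewrite mulr_sumr wn; apply: ler_sum => i _; exact: step.
Qed.

Lemma block_descent x i (v : H i) :
  f (set_block x (x i + v)) <= f x + inner (grad f x i) v + L i / 2 * `|v| ^+ 2.
Proof.
have dsc := @descent _ _ f f_diff x (set_block 0 v); have lip := grad_block_lip.
move: (grad f) dsc lip => G dsc lip.
have xD t : x + t *: set_block 0 v = set_block x (x i + t *: v) by exact: set_blockD.
have slope t : 0 < t < 1 ->
    inner (G (x + t *: set_block 0 v) - G x) (set_block 0 v)
      <= L i * `|v| ^+ 2 * t.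
  move=> /andP[t0 t1]; rewrite xD inner_set_block.
  rewrite -[X in inner X v]/(G (set_block x (x i + t *: v)) i - G x i).
  apply: le_trans (le_inner_norm _ _) _.
  have := @lip x i (x i + t *: v, x i) (conj I I); rewrite /= set_block_id.
  rewrite addrAC subrr add0r normrZ (gtr0_norm t0) => h.
  by apply: le_trans (ler_wpM2r (normr_ge0 v) h) _; rewrite le_eqVlt; apply/orP; left; apply/eqP; ring.
have := dsc _ slope.
by rewrite inner_set_block -[X in x + X]scale1r xD scale1r mulrAC.
Qed.

(** Lipschitz continuity is only assumed along blocks, so the sum of the block
    norms replaces the norm of [x - y]. *)
Lemma joint_descent x y :
  f x <= f y + inner (grad f y) (x - y) + Lres / 2 * (\sum_i `|x i - y i|) ^+ 2.
Proof.
set S := \sum_i _.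
have slope t : 0 < t < 1 ->
    inner (grad f (y + t *: (x - y)) - grad f y) (x - y) <= Lres * S ^+ 2 * t.
  move=> /andP[t0 t1]; apply: le_trans (le_inner_norm _ _) _.
  have := grad_dist (y + t *: (x - y)) y.
  have -> : \sum_i `|(y + t *: (x - y)) i - y i| = t * S.
    rewrite mulr_sumr; apply: eq_bigr => i _.
    rewrite -[(y + _) i]/(y i + t *: (x i - y i)) addrAC subrr add0r.
    by rewrite normrZ gtr0_norm.
  have xyS : `|x - y| <= S by exact: norm_le_sum_coord.
  move=> h; apply: le_trans (ler_wpM2r (normr_ge0 _) h) _.
  have LtS : 0 <= Lres * (t * S) by exact: le_trans h.
  apply: le_trans (ler_wpM2l LtS xyS) _.
  by rewrite le_eqVlt; apply/orP; left; apply/eqP; ring.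
have := descent f_diff slope.
by rewrite (addrC y) subrK mulrAC.
Qed.

End block_lipschitz.

(** * One step of the algorithm *)

Section one_step.
Context (R : realType) (n : nat) (H : 'I_n.+1 -> hilbertType R).

Context (f : direct_sum H -> R) (g : forall i, H i -> \bar R).
Arguments g : clear implicits.
Context (gam L : 'I_n.+1 -> R) (Lres : R).
Hypotheses (f_convex : convex_function [set: convex_lmodType (direct_sum H)] f)
  (f_diff : forall x : direct_sum H, differentiable f x)
  (g_proper : forall i, eproper (g i)) (g_convex : forall i, econvex (g i))
  (g_lsc : forall i, lower_semicontinuous (g i)) (gam_gt0 : forall i, 0 < gam i)
  (grad_lip : forall (x : direct_sum H) i,
     Lres.-lipschitz (fun u : H i => grad f (set_block x u)))
  (grad_block_lip : forall (x : direct_sum H) i,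
     (L i).-lipschitz (fun u : H i => grad f (set_block x u) i)).
Implicit Types x y z : direct_sum H.

Definition objective x : R := f x + sep_sumr g x.

(** The forward-backward direction at [x] with the gradient taken at [y]; locked,
    since only its variational inequalities matter. *)
Definition fb_dir : direct_sum H -> direct_sum H -> direct_sum H :=
  locked (fun x y i => block_prox g gam (x i - gam i *: grad f y i) - x i).

Definition fb_step x y i : direct_sum H := set_block x (x i + fb_dir x y i).

(** First-order model, with the gradient at [y], of the variation of the objective
    when block [i] moves, increased by the square that the proximal inequality
    gains; this is why it is still nonpositive. *)
Definition block_gap x y i : R :=
  inner (grad f y i) (fb_dir x y i) + fine (g i (x i + fb_dir x y i))
  - fine (g i (x i)) + (gam i)^-1 * `|fb_dir x y i| ^+ 2.

Local Notation D := fb_dir.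
Local Notation B := block_gap.
Let del x y i : H i := grad f x i - grad f y i.
Let e x y i : H i := (gam i)^-1 *: (D x y i - D x x i).

Let fb_dirE x y i : x i + D x y i = block_prox g gam (x i - gam i *: grad f y i).
Proof. by rewrite /fb_dir -lock addrC subrK. Qed.

Lemma in_dom_fb_step x y i : in_dom g x -> in_dom g (fb_step x y i).
Proof.
move=> gx j; have [->|ji] := eqVneq j i; last by rewrite /fb_step set_block_neq.
by rewrite /fb_step set_blockE fb_dirE; exact: block_prox_fin_num.
Qed.

Lemma objective_fb_step x y i : in_dom g x ->
  objective (fb_step x y i) <= objective x + B x y i + inner (D x y i) (del x y i)
    + (L i / 2 - (gam i)^-1) * `|D x y i| ^+ 2.
Proof.
move=> gx; have := @block_descent _ _ _ _ f_diff _ grad_block_lip x i (D x y i).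
have sE : sep_sumr g (fb_step x y i) =
    sep_sumr g x - fine (g i (x i)) + fine (g i (x i + D x y i)).
  rewrite /sep_sumr (bigD1 i)//= [in RHS](bigD1 i)//= /fb_step set_blockE.
  rewrite (eq_bigr (fun j => fine (g j (x j)))); first by rewrite -/(D x y i); ring.
  by move=> j ji; rewrite set_block_neq.
rewrite /objective sE /block_gap -/(fb_step x y i) /del; move: (grad f) => G.
rewrite innerDr innerNr (innerC (D x y i) (G x i)) (innerC (D x y i) (G y i)).
move: (f (fb_step x y i)) (f x) (sep_sumr g x) => F1 F0 G0.
move: (fine (g i (x i))) (fine (g i (x i + D x y i))) => g0 g1.
move: (inner (G x i) (D x y i)) (inner (G y i) (D x y i)) => ix iy.
by move: (`|D x y i| ^+ 2) => d; lra.
Qed.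

(** The variational inequality of the proximal point, tested at the old block. *)
Lemma block_gap_le0 x y i : in_dom g x -> B x y i <= 0.
Proof.
move=> gx; have := block_prox_variational g_proper g_convex g_lsc gam_gt0
  (x i - gam i *: grad f y i) (gx i).
rewrite -fb_dirE /B /block_gap -/(D x y i); move: (D x y i) => d.
have -> : x i - gam i *: grad f y i - (x i + d) = - (d + gam i *: grad f y i).
  by rewrite opprD addrACA subrr add0r [RHS]opprD addrC.
have -> : x i - (x i + d) = - d by rewrite opprD addNKr.
rewrite innerNl innerNr opprK innerDl innerZl inner_normE mulrDr.
rewrite (mulKf (lt0r_neq0 (gam_gt0 i))).
move: (fine (g i (x i))) (fine (g i (x i + d))) (`|d| ^+ 2) (inner _ _) => a b q r.
by lra.
Qed.

(** The variational inequality of the proximal point, tested at the block of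
    [z]. *)
Lemma block_gap_le x y z i : in_dom g z -> B x y i <=
  fine (g i (z i)) - fine (g i (x i)) + inner (grad f y i) (z i - x i)
  + (gam i)^-1 * inner (D x y i) (z i - x i).
Proof.
move=> gz; have := block_prox_variational g_proper g_convex g_lsc gam_gt0
  (x i - gam i *: grad f y i) (gz i).
rewrite -fb_dirE /B /block_gap -/(D x y i); move: (D x y i) => d.
have -> : x i - gam i *: grad f y i - (x i + d) = - (d + gam i *: grad f y i).
  by rewrite opprD addrACA subrr add0r [RHS]opprD addrC.
have -> : z i - (x i + d) = (z i - x i) - d by rewrite opprD addrA.
move: (z i - x i) => w.
rewrite innerNl innerDr innerNr !innerDl !innerZl inner_normE opprD opprK.
have -> : (gam i)^-1 * (- (inner d w + gam i * inner (grad f y i) w)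
    + (`|d| ^+ 2 + gam i * inner (grad f y i) d)) =
    (gam i)^-1 * `|d| ^+ 2 - (gam i)^-1 * inner d w - inner (grad f y i) w
    + inner (grad f y i) d by field; rewrite gt_eqF.
move: (fine (g i (x i))) (fine (g i (z i))) (fine (g i (x i + d))) => a0 a1 a2.
move: (inner d w) (inner _ d) (inner _ w) (`|d| ^+ 2) => i1 i2 i3 q.
by lra.
Qed.

(** Convexity at [y] handles [z], and the descent lemma from [y] to [x] measures
    the error due to the gradient being taken at [y] instead of [x]. *)
Lemma sum_block_gap_le x y z : in_dom g z ->
  \sum_i B x y i <= objective z - objective x
    + Lres / 2 * (\sum_i `|x i - y i|) ^+ 2 + winner gam (fun i => D x y i) (z - x).
Proof.
move=> gz.
have h1 := grad_convex f_diff f_convex y z.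
have h2 := joint_descent f_diff grad_lip x y.
have h3 : \sum_i B x y i <= sep_sumr g z - sep_sumr g x + inner (grad f y) (z - x)
    + winner gam (fun i => D x y i) (z - x).
  rewrite /sep_sumr -sumrB inner_direct_sum /winner -!big_split /=.
  by apply: ler_sum => i _; exact: block_gap_le.
rewrite /objective; move: h1 h2 h3; rewrite !innerDr !innerNr; lra.
Qed.

(** Firm nonexpansiveness of the proximal map, read on the difference between
    the delayed and the exact forward-backward directions. *)
Lemma fb_dir_firm x y i : `|e x y i| ^+ 2 <= inner (del x y i) (e x y i).
Proof.
have firm (u v a c : H i) : a = block_prox g gam u -> c = block_prox g gam v ->
    `|a - c| ^+ 2 <= inner (a - c) (u - v).
  by move=> -> ->; exact: block_prox_firm.
have := firm _ _ _ _ (fb_dirE x y i) (fb_dirE x x i).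
have -> : x i + D x y i - (x i + D x x i) = gam i *: e x y i.
  by rewrite /e scalerA mulfV ?gt_eqF// scale1r opprD addrACA subrr add0r.
have -> : x i - gam i *: grad f y i - (x i - gam i *: grad f x i) = gam i *: del x y i.
  by rewrite opprB addrC addrA subrK -scalerBr.
rewrite normrZ exprMn innerZl innerZr (gtr0_norm (gam_gt0 i)) innerC mulrA -expr2.
by rewrite ler_pM2l// exprn_gt0.
Qed.

Lemma sqr_norm_exact_dir x y i : (gam i)^-1 * `|D x x i| ^+ 2 =
  (gam i)^-1 * `|D x y i| ^+ 2 - 2 * inner (D x y i) (e x y i) + gam i * `|e x y i| ^+ 2.
Proof.
have -> : D x x i = D x y i - gam i *: e x y i.
  by rewrite /e scalerA mulfV ?gt_eqF// scale1r opprB addrC subrK.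
rewrite sqr_normB innerZr normrZ exprMn (gtr0_norm (gam_gt0 i)).
move: (inner _ _) (`|D x y i| ^+ 2) (`|e x y i| ^+ 2) => a q r.
by field; rewrite gt_eqF.
Qed.

(** The error bound is about [D x x], while [D x y] drives the algorithm: their
    product is replaced by the mean of the squares, in which [D x x] is
    [D x y - gam e]. *)
Lemma sum_block_gap_error_bound x y (S : set (direct_sum H)) (C Fs : R) :
  S !=set0 -> (forall z, S z -> in_dom g z /\ objective z = Fs) ->
  0 <= C -> wdist gam x S <= C * wnorm gam (fun i => D x x i) ->
  \sum_i B x y i <= Fs - objective x + Lres / 2 * (\sum_i `|x i - y i|) ^+ 2
    + C * \sum_i ((gam i)^-1 * `|D x y i| ^+ 2 - inner (D x y i) (e x y i)
                  + gam i / 2 * `|e x y i| ^+ 2).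
Proof.
move=> S0 Smin C0 eb; set err := Lres / 2 * _.
have h : \sum_i B x y i - (Fs - objective x + err)
    <= wnorm gam (fun i => D x y i) * wdist gam x S.
  apply: ge_wdist => //; first exact: wnorm_ge0.
  move=> z /Smin[gz zF]; have := sum_block_gap_le x y gz.
  have := le_winner_wnorm gam_gt0 (fun i => D x y i) (z - x).
  rewrite -(wnormN _ (z - x)) opprB zF -/err.
  by move: (\sum_i B x y i) (winner _ _ _) (_ * wnorm gam (x - z)) => a q r; lra.
have d2 := sqr_wnorm gam_gt0 (fun i => D x y i).
have d'2 : wnorm gam (fun i => D x x i) ^+ 2 = \sum_i ((gam i)^-1 * `|D x y i| ^+ 2
    - 2 * inner (D x y i) (e x y i) + gam i * `|e x y i| ^+ 2).
  by rewrite (sqr_wnorm gam_gt0); apply: eq_bigr => i _; exact: sqr_norm_exact_dir.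
have d0 : 0 <= wnorm gam (fun i => D x y i) by exact: wnorm_ge0.
move: h eb d2 d'2 d0.
move: (wnorm gam (fun i => D x x i)) (wnorm gam (fun i => D x y i)) => d' d h eb d2 d'2 d0.
have {}h : \sum_i B x y i - (Fs - objective x + err) <= C * (d * d').
  by apply: le_trans h _; rewrite mulrCA ler_wpM2l.
have amgm : d * d' <= 2^-1 * (d ^+ 2 + d' ^+ 2).
  by have : 0 <= (d - d') ^+ 2 by [exact: sqr_ge0]; rewrite sqrrB; lra.
have E : 2^-1 * (d ^+ 2 + d' ^+ 2) = \sum_i ((gam i)^-1 * `|D x y i| ^+ 2
    - inner (D x y i) (e x y i) + gam i / 2 * `|e x y i| ^+ 2).
  rewrite d2 d'2.
  rewrite -big_split mulr_sumr; apply: eq_bigr => i _ /=.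
  by move: (inner _ _) (_ * `|D x y i| ^+ 2) (`|e x y i| ^+ 2) => a q r; field.
have := ler_wpM2l C0 amgm; rewrite E; move: h.
by move: (\sum_i B x y i) (\sum_i _) (C * (d * d')) => a q r; lra.
Qed.

Context (p : 'I_n.+1 -> R) (pmin pmax eta bet : R) (tau : nat).
Hypotheses (p_sum : \sum_i p i = 1) (pmin_gt0 : 0 < pmin)
  (p_ge : forall i, pmin <= p i) (p_le : forall i, p i <= pmax)
  (bet_gt0 : 0 < bet) (pmax_bet : pmax * Lres ^+ 2 <= bet ^+ 2)
  (L_ge0 : forall i, 0 <= L i) (eta_gt0 : 0 < eta) (Lres_gt0 : 0 < Lres)
  (step_small : forall i, eta + L i * gam i / 2 + gam i * (bet * tau%:R) <= 1).
Local Notation b := (bet * tau%:R).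

Let b_ge0 : 0 <= b. Proof. by rewrite mulr_ge0// ltW. Qed.

Let gam_b i : gam i * b <= 1.
Proof.
have := step_small i; have := mulr_ge0 (L_ge0 i) (ltW (gam_gt0 i)).
by move: (L i * gam i) (gam i * b) eta_gt0 => u v; lra.
Qed.

Let eta_le1 : eta <= 1.
Proof.
have := step_small ord0; have := mulr_ge0 (L_ge0 ord0) (ltW (gam_gt0 ord0)).
by have := mulr_ge0 (ltW (gam_gt0 ord0)) b_ge0; lra.
Qed.

Let step_smallV i : eta * (gam i)^-1 + L i / 2 - (gam i)^-1 + b <= 0.
Proof.
rewrite -(@pmulr_rle0 _ (gam i))//.
have -> : gam i * (eta * (gam i)^-1 + L i / 2 - (gam i)^-1 + b) =
    eta + L i * gam i / 2 + gam i * b - 1 by field; rewrite gt_eqF.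
by have := step_small i; lra.
Qed.

Let p_gt0 i : 0 < p i. Proof. exact: lt_le_trans (p_ge i). Qed.

Context (x y : direct_sum H) (s2 : R).
Hypotheses (x_dom : in_dom g x) (s2_ge0 : 0 <= s2)
  (delay_small : (\sum_i `|x i - y i|) ^+ 2 <= tau%:R * s2).

Let sum_del : pmax * b^-1 * (\sum_i `|del x y i| ^+ 2) <= bet * s2.
Proof.
have pmax0 : 0 < pmax by exact: lt_le_trans (p_gt0 ord0) (p_le ord0).
have h1 : \sum_i `|del x y i| ^+ 2 <= Lres ^+ 2 * (tau%:R * s2).
  have -> : \sum_i `|del x y i| ^+ 2 = `|grad f x - grad f y| ^+ 2.
    by rewrite sqr_norm_direct_sum.
  apply: le_trans (_ : _ <= (Lres * \sum_i `|x i - y i|) ^+ 2) _.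
    by rewrite ler_pXn2r// ?nnegrE ?mulr_ge0 ?sumr_ge0 ?(ltW Lres_gt0)// grad_dist.
  by rewrite exprMn ler_wpM2l// sqr_ge0.
have c0 : 0 <= pmax * b^-1 by rewrite mulr_ge0 ?invr_ge0// ltW.
apply: le_trans (ler_wpM2l c0 h1) _.
have -> : pmax * b^-1 * (Lres ^+ 2 * (tau%:R * s2)) =
  (pmax * Lres ^+ 2) * (b^-1 * tau%:R * s2) by ring.
have q0 : 0 <= b^-1 * tau%:R * s2 by rewrite !mulr_ge0 ?invr_ge0.
apply: le_trans (ler_wpM2r q0 pmax_bet) _.
have -> : bet ^+ 2 * (b^-1 * tau%:R * s2) = (b^-1 * b) * (bet * s2) by ring.
have bs0 : 0 <= bet * s2 by rewrite mulr_ge0// ltW.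
have [->|b1] := eqVneq b 0; first by rewrite mulr0 mul0r.
by rewrite mulVf// mul1r.
Qed.

(* When there is no delay, [b = 0] and the two gradients coincide. *)
Let absorb (mu c : R) i : 0 < mu -> 0 <= c <= mu ->
  mu * inner (D x y i) (del x y i) - c * inner (D x y i) (e x y i)
    + c * gam i / 2 * `|e x y i| ^+ 2 <=
  mu * b / 2 * `|D x y i| ^+ 2 + mu * b^-1 / 2 * `|del x y i| ^+ 2.
Proof.
move=> mu0 c01; have [b0|b0] := eqVneq b 0; last first.
  by apply: cross_absorb => //; [rewrite lt_def b0|exact: fb_dir_firm].
have xy : x = y.
  have t0 : tau%:R = 0 :> R.
    by apply/eqP; move/eqP: b0; rewrite mulf_eq0 gt_eqF.
  apply/functional_extensionality_dep => j; apply/eqP; rewrite -subr_eq0 -normr_le0.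
  have : \sum_i `|x i - y i| <= 0.
    move: delay_small; rewrite t0 mul0r => h.
    by rewrite leNgt; apply/negP => /(exprn_gt0 2); rewrite ltNge h.
  apply: le_trans; rewrite (bigD1 j)//= lerDl; exact: sumr_ge0.
rewrite b0 invr0 /del /e xy !subrr inner0r scaler0 inner0r normr0.
by rewrite expr0n /= !mulr0 !mul0r subr0 addr0.
Qed.

(** Young's inequality splits the cross term between the gradient error and the
    direction. The latter part uses half of the slack [b] left by the stepsize
    condition; the other half is kept for the memory term of the Lyapunov
    function. *)
Lemma expected_decrease :
  \sum_i p i * objective (fb_step x y i) <= objective x
    - eta * (\sum_i p i / gam i * `|D x y i| ^+ 2)
    - b / 2 * (\sum_i p i * `|D x y i| ^+ 2) + bet / 2 * s2.
Proof.
have sd := sum_del.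
suff : \sum_i p i * objective (fb_step x y i) <= \sum_i (p i * objective x
    - eta * (p i / gam i * `|D x y i| ^+ 2) - b / 2 * (p i * `|D x y i| ^+ 2)
    + 2^-1 * (pmax / b * `|del x y i| ^+ 2)).
  rewrite !big_split /= !sumrN -!mulr_sumr -mulr_suml p_sum mul1r => h.
  by lra.
apply: ler_sum => i _.
apply: le_trans (ler_wpM2l (ltW (p_gt0 i)) (objective_fb_step y i x_dom)) _.
have gap := block_gap_le0 y i x_dom.
have h : (eta * (gam i)^-1 + L i / 2 - (gam i)^-1 + b) * `|D x y i| ^+ 2 <= 0.
  by rewrite mulr_le0_ge0// sqr_ge0.
have := @absorb 1 0 i ltr01 (ltac:(by rewrite lexx ler01)).
have pd : p i * (b^-1 * `|del x y i| ^+ 2) <= pmax * (b^-1 * `|del x y i| ^+ 2).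
  by rewrite ler_wpM2r// mulr_ge0 ?invr_ge0 ?sqr_ge0.
rewrite !mul1r !mul0r subr0 addr0 => h2.
have : p i * (B x y i + inner (D x y i) (del x y i)
    + (L i / 2 - (gam i)^-1) * `|D x y i| ^+ 2) <=
  p i * (- (eta * (gam i)^-1 * `|D x y i| ^+ 2) - b / 2 * `|D x y i| ^+ 2
     + b^-1 / 2 * `|del x y i| ^+ 2).
  by rewrite ler_pM2l//; lra.
lra.
Qed.

Context (lam C Fs : R) (S : set (direct_sum H)).
Hypotheses (lam_ge1 : 1 <= lam) (C_ge0 : 0 <= C) (C_le : C <= lam * eta)
  (S_neq0 : S !=set0) (S_min : forall z, S z -> in_dom g z /\ objective z = Fs)
  (x_error_bound : wdist gam x S <= C * wnorm gam (fun i => D x x i)).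

(** Of the total weight [lam p i] given to the descent inequality of block [i],
    a part [pmin] uses the error bound and the remaining one only uses that the
    block gap is nonpositive. As [pmin C <= lam p i eta], the margin absorbs the
    square of the direction that the error bound produces. *)
Lemma expected_gap_decrease :
  lam * (\sum_i p i * objective (fb_step x y i)) <= lam * objective x
    - pmin * (objective x - Fs) + pmin * (Lres / 2 * (tau%:R * s2))
    - lam * (b / 2 * (\sum_i p i * `|D x y i| ^+ 2)) + lam * (bet / 2 * s2).
Proof.
have lam0 : 0 < lam by exact: lt_le_trans lam_ge1.
have sd := sum_del.
pose T i := (gam i)^-1 * `|D x y i| ^+ 2 - inner (D x y i) (e x y i)
                  + gam i / 2 * `|e x y i| ^+ 2.
have gapE := sum_block_gap_error_bound y S_neq0 S_min C_ge0 x_error_bound.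
rewrite -/(T _) in gapE.
have {}gapE : pmin * (\sum_i B x y i) <=
    pmin * (Fs - objective x + Lres / 2 * (tau%:R * s2) + C * \sum_i T i).
  rewrite ler_pM2l//; apply: le_trans gapE _.
  by rewrite lerD2r lerD2l ler_wpM2l// divr_ge0// ltW.
suff : \sum_i lam * (p i * objective (fb_step x y i)) <= \sum_i (lam * (p i * objective x)
    + pmin * B x y i - pmin * (C * T i)
    - lam * (b / 2 * (p i * `|D x y i| ^+ 2))
    + lam * (2^-1 * (pmax / b * `|del x y i| ^+ 2))).
  rewrite !big_split /= !sumrN -!mulr_sumr -mulr_suml p_sum mul1r => h.
  by have := ler_wpM2l (ltW lam0) sd; lra.
apply: ler_sum => i _.
have lp0 : 0 < lam * p i by rewrite mulr_gt0.
rewrite mulrA.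
apply: le_trans (ler_wpM2l (ltW lp0) (objective_fb_step y i x_dom)) _.
have gap : (lam * p i - pmin) * B x y i <= 0.
  rewrite mulr_ge0_le0 ?block_gap_le0// subr_ge0.
  by apply: le_trans (p_ge i) _; rewrite ler_peMl// ltW.
have h : lam * p i * ((eta * (gam i)^-1 + L i / 2 - (gam i)^-1 + b) * `|D x y i| ^+ 2) <= 0.
  by rewrite mulr_ge0_le0 ?(ltW lp0)// mulr_le0_ge0// sqr_ge0.
have pmC : pmin * C <= lam * p i * eta.
  apply: le_trans (_ : p i * C <= _); first by rewrite ler_wpM2r.
  by rewrite mulrAC (mulrC _ (p i)) ler_pM2l.
have cmu : 0 <= pmin * C <= lam * p i.
  rewrite mulr_ge0 ?(ltW pmin_gt0)//=; apply: le_trans pmC _.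
  by rewrite ger_pMr.
have ab := absorb i lp0 cmu.
have pd : lam * (p i * (b^-1 * `|del x y i| ^+ 2)) <= lam * (pmax * (b^-1 * `|del x y i| ^+ 2)).
  by rewrite ler_pM2l// ler_wpM2r// mulr_ge0 ?invr_ge0 ?sqr_ge0.
have ga : pmin * C * ((gam i)^-1 * `|D x y i| ^+ 2) <=
    lam * p i * eta * ((gam i)^-1 * `|D x y i| ^+ 2).
  by rewrite ler_wpM2r// mulr_ge0 ?sqr_ge0// invr_ge0 ltW.
rewrite /T; lra.
Qed.

End one_step.

(** * Expectations over finite histories *)

Section histories.
Context d (Omega : measurableType d) (R : realType) (P : probability Omega R).
Context (n : nat) (ik : nat -> {RV P >-> 'I_n.+1}) (p : 'I_n.+1 -> R).

Definition hist k (w : Omega) : {ffun 'I_k -> 'I_n.+1} := [ffun j => ik (val j) w].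

(** Measurability with respect to the first [k] draws: these take finitely many
    values, so that being a function of them suffices, whatever the target. *)
Definition adapted (T : Type) k (h : Omega -> T) :=
  forall w w', hist k w = hist k w' -> h w = h w'.

Lemma histP k w w' : hist k w = hist k w' <-> forall j, (j < k)%N -> ik j w = ik j w'.
Proof.
split=> [/ffunP h j jk|h]; first by have := h (Ordinal jk); rewrite !ffunE.
by apply/ffunP => j; rewrite !ffunE; apply: h; exact: ltn_ord.
Qed.

Lemma adapted_le T k l (h : Omega -> T) : (k <= l)%N -> adapted k h -> adapted l h.
Proof.
move=> kl ah w w' e; apply: ah; apply/histP => j jk; move/histP in e.
by apply: e; rewrite (leq_trans jk kl).
Qed.

Lemma adapted_comp T U k (h : Omega -> T) (F : T -> U) :
  adapted k h -> adapted k (fun w => F (h w)).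
Proof. by move=> ah w w' /ah ->. Qed.

Lemma adapted_comp2 T U W k (h : Omega -> T) (l : Omega -> U) (F : T -> U -> W) :
  adapted k h -> adapted k l -> adapted k (fun w => F (h w) (l w)).
Proof. by move=> ah al w w' e; rewrite (ah _ _ e) (al _ _ e). Qed.

Lemma adapted_sum (I : Type) (s : seq I) (Q : pred I) k (h : I -> Omega -> R) :
  (forall i, Q i -> adapted k (h i)) -> adapted k (fun w => \sum_(i <- s | Q i) h i w).
Proof. by move=> ah w w' e; apply: eq_bigr => i Qi; exact: ah. Qed.

Lemma measurable_hist k t : measurable (hist k @^-1` [set t]).
Proof.
rewrite (_ : _ @^-1` _ = \bigcap_(j in [set: 'I_k]) (ik (val j) @^-1` [set t j])).
  apply: fin_bigcap_measurable => // j _.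
  by rewrite -[X in measurable X]setTI; exact: measurable_funP.
apply/seteqP; split => [w /= <- j _|w /= h]; first by rewrite ffunE.
by apply/ffunP => j; rewrite ffunE; exact: h.
Qed.

Lemma measurable_adapted T k (h : Omega -> T) (A : set T) :
  adapted k h -> measurable (h @^-1` A).
Proof.
move=> ah; pose B := [set t | exists2 w, hist k w = t & A (h w)].
rewrite (_ : _ @^-1` _ = \bigcup_(t in B) (hist k @^-1` [set t])).
  by apply: fin_bigcup_measurable => // t _; exact: measurable_hist.
apply/seteqP; split => [w /= Aw|w [_ [w' <- Aw'] /= e]].
  by exists (hist k w) => //; exists w.
by rewrite (ah _ _ e).
Qed.

Lemma measurable_fun_adapted k (h : Omega -> R) :
  adapted k h -> measurable_fun setT h.
Proof. by move=> ah _ Y _; rewrite setTI; exact: measurable_adapted ah. Qed.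

Lemma adapted_repr k (h : Omega -> R) : adapted k h ->
  exists c, forall w, h w = c (hist k w).
Proof.
move=> ah; have /choice[c hc] : forall t : {ffun 'I_k -> 'I_n.+1}, exists r : R,
    forall w, hist k w = t -> h w = r.
  move=> t; have [[w0 <-]|no] := pselect (exists w, hist k w = t).
    by exists (h w0) => w /ah.
  by exists 0 => w wt; exfalso; apply: no; exists w.
by exists c => w; exact: hc.
Qed.

Lemma integrable_adapted k (h : Omega -> R) :
  adapted k h -> P.-integrable setT (EFin \o h).
Proof.
move=> ah; have [c hc] := adapted_repr ah.
apply: (measurable_bounded_integrable (A := setT)) => //.
- by rewrite (le_lt_trans (probability_le1 _ _))// ltry.
- exact: measurable_fun_adapted ah.
exists (\sum_t `|c t|); split; first exact: num_real.
move=> y cy w _ /=; apply: le_trans (ltW cy).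
by rewrite hc (bigD1 (hist k w))//= lerDl sumr_ge0.
Qed.

Local Notation E h := (Rintegral P setT h).

Lemma EFin_expect k (h : Omega -> R) : adapted k h ->
  (\int[P]_w (h w)%:E = (E h)%:E)%E.
Proof. by move=> /integrable_adapted ih; rewrite fineK// integrable_fin_num. Qed.

Lemma eq_expect (h l : Omega -> R) : h =1 l -> E h = E l.
Proof. by move=> hl; apply: eq_Rintegral => w _; exact: hl. Qed.

Lemma expect_cst (r : R) : E (fun=> r) = r.
Proof.
have -> : E (fun=> r) = r * fine (P setT) by exact: Rintegral_cst.
by rewrite probability_setT /= mulr1.
Qed.

Lemma expectD k (h l : Omega -> R) : adapted k h -> adapted k l ->
  E (fun w => h w + l w) = E h + E l.
Proof.
by move=> ah al; rewrite RintegralD//; [exact: integrable_adapted ah|exact: integrable_adapted al].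
Qed.

Lemma expectZ k (r : R) (h : Omega -> R) : adapted k h ->
  E (fun w => r * h w) = r * E h.
Proof. by move=> ah; rewrite RintegralZl//; exact: integrable_adapted ah. Qed.

Lemma expect_le k (h l : Omega -> R) : adapted k h -> adapted k l ->
  (forall w, h w <= l w) -> E h <= E l.
Proof.
move=> ah al hl; apply: le_Rintegral => //; first exact: integrable_adapted ah.
exact: integrable_adapted al.
Qed.

Lemma expect_ge0 (h : Omega -> R) : (forall w, 0 <= h w) -> 0 <= E h.
Proof. by move=> h0; apply: Rintegral_ge0. Qed.

Lemma expect_sum (I : Type) (s : seq I) k (h : I -> Omega -> R) :
  (forall i, adapted k (h i)) ->
  E (fun w => \sum_(i <- s) h i w) = \sum_(i <- s) E (h i).
Proof.
move=> ah; elim: s => [|a s IH].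
  by rewrite big_nil -[RHS]expect_cst; apply: eq_expect => w; rewrite big_nil.
rewrite big_cons -IH -(@expectD k)//; last by apply: adapted_sum.
by apply: eq_expect => w; rewrite big_cons.
Qed.

(** Jensen's inequality for the square, from the positivity of the variance. *)
Lemma sqr_expect_le k (h : Omega -> R) : adapted k h ->
  E h ^+ 2 <= E (fun w => h w ^+ 2).
Proof.
move=> ah; set m := E h.
have : 0 <= E (fun w => h w ^+ 2 + (- 2 * m * h w + m ^+ 2)).
  apply: expect_ge0 => w; have : 0 <= (h w - m) ^+ 2 by exact: sqr_ge0.
  by rewrite sqrrB; lra.
have a2 : adapted k (fun w => h w ^+ 2) by exact: (adapted_comp (fun r => r ^+ 2) ah).
have a1 : adapted k (fun w => - 2 * m * h w) by exact: (adapted_comp (fun r => - 2 * m * r) ah).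
have a0 : adapted k (fun w : Omega => m ^+ 2) by [].
rewrite (@expectD k)//; last exact: adapted_comp2 a1 a0.
by rewrite (@expectD k)// (expectZ _ ah) expect_cst -/m; lra.
Qed.

Lemma expect_bool (B : Omega -> bool) : measurable [set w | B w] ->
  E (fun w => (B w)%:R) = fine (P [set w | B w]).
Proof.
move=> mB; rewrite /Rintegral.
under eq_integral => w _.
  have -> : ((B w)%:R : R) = \1_[set w | B w] w.
    by rewrite indicE; congr (_ : bool)%:R; apply/idP/idP; rewrite inE.
  over.
by rewrite integral_indic// setIT.
Qed.

Hypotheses (p_gt0 : forall i, 0 < p i) (ik_iid : iid_with_law ik p).

(** Mutual independence, applied to the finite set of the first [k] indices. *)
Lemma prob_cylinder k (t : nat -> 'I_n.+1) :
  P [set w | forall j, (j < k)%N -> ik j w = t j] = (\prod_(j < k) p (t j))%:E.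
Proof.
have [indep law] := ik_iid.
pose J : {fset nat} := [fset j in iota 0 k]%fset.
have := indep J (fun j => [set t j]) (fun=> I).
rewrite (_ : \bigcap_(j in _) _ = [set w | forall j, (j < k)%N -> ik j w = t j]); last first.
  apply/seteqP; split => w /= h j; last by rewrite /= !inE mem_iota => /h.
  by move=> jk; apply: h; rewrite /= !inE mem_iota.
move=> ->; have -> : (\prod_(j <- J) P (ik j @^-1` [set t j]) =
    \prod_(j <- iota 0 k) P (ik j @^-1` [set t j]))%E.
  apply: perm_big; apply: uniq_perm; rewrite ?fset_uniq ?iota_uniq// => j.
  by rewrite !inE.
rewrite -{1}(subn0 k) -/(index_iota 0 k) big_mkord -prodEFin.
by apply: eq_bigr => j _; exact: law.
Qed.

Lemma prob_hist k w0 : P [set w | hist k w = hist k w0] = (\prod_(j < k) p (ik j w0))%:E.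
Proof.
rewrite -(prob_cylinder k (fun j => ik j w0)).
by congr (P _); apply/seteqP; split => w /= /histP.
Qed.

Lemma prob_hist_next k w0 i :
  P [set w | hist k w = hist k w0 /\ ik k w = i] =
  (p i * \prod_(j < k) p (ik j w0))%:E.
Proof.
pose t j := if (j < k)%N then ik j w0 else i.
have -> : p i * \prod_(j < k) p (ik j w0) = \prod_(j < k.+1) p (t j).
  rewrite big_ord_recr /= /t ltnn mulrC; congr (_ * _).
  by apply: eq_bigr => j _; rewrite ltn_ord.
rewrite -prob_cylinder; congr (P _); apply/seteqP; split => w /=.
  move=> [/histP e ki] j; rewrite ltnS leq_eqVlt /t => /orP[/eqP->|jk]; last by rewrite jk e.
  by rewrite ltnn.
move=> h; split; last by rewrite h// /t ltnn.
by apply/histP => j jk; rewrite (h j (ltnW jk)) /t jk.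
Qed.

(** Every history has positive probability, hence is met by any event of
    probability one. *)
Lemma ae_hist (Q : Omega -> Prop) k w : {ae P, forall w, Q w} ->
  exists2 w', hist k w' = hist k w & Q w'.
Proof.
move=> [N [mN PN0 QN]]; apply: contrapT => noQ.
have sub : [set w' | hist k w' = hist k w] `<=` N.
  by move=> w' /= e; apply: QN => /= Qw'; apply: noQ; exists w'.
have mh : measurable [set w' | hist k w' = hist k w] by exact: measurable_hist.
have : (P [set w' | hist k w' = hist k w] <= P N)%E by apply: le_measure; rewrite ?inE.
rewrite PN0 prob_hist lee_fin leNgt; apply/negP; rewrite negbK.
by apply: prodr_gt0.
Qed.

Lemma adapted_ae (T : Type) (Y : set T) k (h : Omega -> T) : adapted k h ->
  {ae P, forall w, Y (h w)} -> forall w, Y (h w).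
Proof. by move=> ah aeY w; have [w' /ah <-] := ae_hist k w aeY. Qed.

Lemma sum_law : \sum_i p i = 1.
Proof.
have [_ law] := ik_iid.
have mi i : measurable [set w | ik 0 w == i].
  rewrite (_ : [set w | _] = ik 0 @^-1` [set i]).
    by rewrite -[X in measurable X]setTI; exact: measurable_funP.
  by apply/seteqP; split => w /= /eqP.
rewrite -[RHS]expect_cst.
have a1 i : adapted 1 (fun w => (ik 0 w == i)%:R : R).
  by move=> w w' /histP /(_ 0%N) -> .
transitivity (E (fun w => \sum_i ((ik 0 w == i)%:R : R))).
  rewrite (expect_sum _ a1); apply: eq_bigr => i _; rewrite expect_bool//.
  rewrite (_ : [set w | _] = ik 0 @^-1` [set i]); first by rewrite -[P _]/(distribution P (ik 0) _) law.
  by apply/seteqP; split => w /= /eqP.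
apply: eq_expect => w; rewrite (bigD1 (ik 0 w))//= eqxx big1 ?addr0// => i.
by rewrite eq_sym => /negPf ->.
Qed.

(** Write [h] as a combination of indicators of histories: a history and the next
    draw form a longer history, and probabilities of histories are products. *)
Lemma expect_indep k i (h : Omega -> R) : adapted k h ->
  E (fun w => h w * (ik k w == i)%:R) = p i * E h.
Proof.
move=> ah; have [c hc] := adapted_repr ah.
have mk : measurable [set w | ik k w == i].
  rewrite (_ : [set w | _] = ik k @^-1` [set i]).
    by rewrite -[X in measurable X]setTI; exact: measurable_funP.
  by apply/seteqP; split => w /= /eqP.
have mt t : measurable [set w | hist k w == t].
  rewrite (_ : [set w | _] = hist k @^-1` [set t]); first exact: measurable_hist.
  by apply/seteqP; split => w /= /eqP.
have mtk t : measurable [set w | (hist k w == t) && (ik k w == i)].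
  rewrite (_ : [set w | _] = [set w | hist k w == t] `&` [set w | ik k w == i]).
    exact: measurableI.
  by apply/seteqP; split => w /= /andP.
have at_ t : adapted k (fun w => (hist k w == t)%:R : R) by move=> w w' ->.
have atk t : adapted k.+1 (fun w => ((hist k w == t) && (ik k w == i))%:R : R).
  move=> w w' e; have -> : hist k w = hist k w'.
    by move/histP: e => e; apply/histP => j jk; apply: e; exact: ltnW.
  by move/histP: e => ->.
rewrite (@eq_expect _ (fun w => \sum_t c t * ((hist k w == t) && (ik k w == i))%:R)); last first.
  move=> w; rewrite (bigD1 (hist k w))//= eqxx /= -hc big1 ?addr0// => t.
  by rewrite eq_sym => /negPf ->; rewrite mulr0.
rewrite [E h](@eq_expect _ (fun w => \sum_t c t * (hist k w == t)%:R)); last first.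
  move=> w; rewrite (bigD1 (hist k w))//= eqxx mulr1 -hc big1 ?addr0// => t.
  by rewrite eq_sym => /negPf ->; rewrite mulr0.
rewrite (@expect_sum _ _ k.+1); last by move=> t; exact: (adapted_comp (fun r => c t * r) (atk t)).
rewrite (@expect_sum _ _ k); last by move=> t; exact: (adapted_comp (fun r => c t * r) (at_ t)).
rewrite mulr_sumr; apply: eq_bigr => t _.
rewrite (expectZ _ (atk t)) (expectZ _ (at_ t)) !expect_bool// mulrCA; congr (_ * _).
have [[w0 <-]|no] := pselect (exists w, hist k w = t).
  rewrite (_ : [set w | _ && _] = [set w | hist k w = hist k w0 /\ ik k w = i]).
    rewrite (_ : [set w | _ == _] = [set w | hist k w = hist k w0]).
      by rewrite prob_hist_next prob_hist.
    by apply/seteqP; split => w /= /eqP.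
  by apply/seteqP; split => w /=; [move=> /andP[/eqP ? /eqP ?]|move=> [-> ->]; rewrite !eqxx].
have e0 : [set w | hist k w == t] = set0.
  by rewrite -subset0 => w /= /eqP e; apply: no; exists w.
have e1 : [set w | (hist k w == t) && (ik k w == i)] = set0.
  by rewrite -subset0 => w /= /andP[/eqP e _]; apply: no; exists w.
by rewrite e0 e1 measure0 mulr0.
Qed.

(** Averaging over the next draw, the history being fixed. *)
Lemma expect_next k (A : Omega -> 'I_n.+1 -> R) : (forall i, adapted k (A ^~ i)) ->
  E (fun w => A w (ik k w)) = E (fun w => \sum_i p i * A w i).
Proof.
move=> aA; have aA' i : adapted k.+1 (fun w => A w i * (ik k w == i)%:R).
  apply: adapted_comp2; first by apply: adapted_le (aA i).
  by move=> w w' /histP ->.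
rewrite (@eq_expect _ (fun w => \sum_i A w i * (ik k w == i)%:R)); last first.
  move=> w; rewrite (bigD1 (ik k w))//= eqxx mulr1 big1 ?addr0// => i.
  by rewrite eq_sym => /negPf ->; rewrite mulr0.
rewrite (expect_sum _ aA') (@expect_sum _ _ k); last first.
  by move=> i; exact: (adapted_comp (fun r => p i * r) (aA i)).
by apply: eq_bigr => i _; rewrite (expectZ _ (aA i)) expect_indep.
Qed.

End histories.

(** * Lyapunov contraction and geometric rates *)

Section rates.
Context (R : realType).

Section lyapunov.
Context (tau : nat) (f q V S M : nat -> R) (lam the pmin eta bet Lres gmax : R).
Hypotheses (lam_the : 1 <= lam - the) (pmin_gt0 : 0 < pmin) (pmin_le1 : pmin <= 1)
  (eta_gt0 : 0 < eta) (bet_ge0 : 0 <= bet) (gmax_gt0 : 0 < gmax) (Lres_ge0 : 0 <= Lres)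
  (the_ge0 : 0 <= the)
  (the_ge : pmin * (tau%:R / 2 * (Lres + bet)) * gmax <= the * eta)
  (f_ge0 : forall k, 0 <= f k) (q_ge0 : forall k, 0 <= q k)
  (M0 : M 0 = 0) (M_ge0 : forall k, 0 <= M k)
  (M_S : forall k, M k <= tau%:R * S k)
  (M_next : forall k, M k.+1 = M k + tau%:R * V k - S k)
  (S_V : forall k, S k = \sum_(k - tau <= h < k) V h)
  (V_q : forall k, V k <= gmax * q k)
  (decrease : forall k, f k.+1 <= f k - eta * q k - bet * tau%:R / 2 * V k + bet / 2 * S k)
  (gap_decrease : forall k, lam * f k.+1 <= lam * f k - pmin * f k
     + pmin * (Lres / 2 * (tau%:R * S k)) - lam * (bet * tau%:R / 2 * V k)
     + lam * (bet / 2 * S k)).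

Definition lyapunov k := f k + bet / 2 * M k.
Local Notation G := lyapunov.

Lemma lyapunov_ge k : f k <= G k.
Proof. by rewrite /G lerDl mulr_ge0// divr_ge0. Qed.

Lemma lyapunov_ge0 k : 0 <= G k.
Proof. exact: le_trans (lyapunov_ge k). Qed.

Lemma lyapunov_decrease k : eta * q k <= G k - G k.+1.
Proof. by rewrite /G M_next; have := decrease k; lra. Qed.

Lemma lyapunov_nincr k l : (k <= l)%N -> G l <= G k.
Proof.
elim: l => [|l IH]; first by rewrite leqn0 => /eqP->.
rewrite leq_eqVlt ltnS => /orP[/eqP->//|/IH]; apply: le_trans.
by rewrite -subr_ge0; apply: le_trans (lyapunov_decrease l); rewrite mulr_ge0// ltW.
Qed.

Let sum_decrease k l : (k <= l)%N -> \sum_(k <= h < l) eta * q h <= G k - G l.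
Proof.
move=> kl; rewrite -[leRHS]opprB -telescope_sumr// -sumrN.
by apply: ler_sum => h _; rewrite opprB lyapunov_decrease.
Qed.

(** The delay only looks back [tau] steps, and the memory it involves is paid by
    the decrease of the Lyapunov function along these steps. *)
Lemma lyapunov_contraction k : G k.+1 <= (1 - pmin / lam) * G (k - tau).
Proof.
have lam0 : 0 < lam by have := the_ge0; move: lam_the; lra.
have SG : eta * S k <= gmax * (G (k - tau) - G k).
  have := ler_wpM2l (ltW gmax_gt0) (sum_decrease (leq_subr tau k)).
  apply: le_trans; rewrite S_V !mulr_sumr; apply: ler_sum => h _.
  by rewrite mulrCA ler_pM2l.
have T0 : 0 <= G (k - tau) - G k by rewrite subr_ge0 lyapunov_nincr// leq_subr.
have S0 : 0 <= eta * (tau%:R * S k).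
  by rewrite mulr_ge0 ?(ltW eta_gt0)//; apply: le_trans (M_S k).
have U0 : 0 <= G k - G k.+1 by rewrite subr_ge0 lyapunov_nincr.
have pS : pmin * (tau%:R / 2 * (Lres + bet)) * S k <= the * (G (k - tau) - G k).
  rewrite -(ler_pM2l eta_gt0).
  have c0 : 0 <= pmin * (tau%:R / 2 * (Lres + bet)).
    by rewrite !mulr_ge0 ?(ltW pmin_gt0)// addr_ge0.
  have h1 := ler_wpM2l c0 SG; have h2 := ler_wpM2r T0 the_ge.
  by rewrite mulrCA; apply: le_trans h1 _; rewrite mulrA [leRHS]mulrA [eta * _]mulrC.
have h : pmin * G (k - tau) <= lam * (G (k - tau) - G k.+1).
  have := gap_decrease k; have := M_next k.
  have : pmin * (bet / 2 * M k) <= pmin * (bet / 2 * (tau%:R * S k)).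
    by rewrite ler_pM2l// ler_wpM2l// divr_ge0.
  have : (pmin + the) * (G (k - tau) - G k) <= lam * (G (k - tau) - G k).
    by rewrite ler_wpM2r//; move: lam_the pmin_le1; lra.
  move: pS; rewrite /G; move: (f k) (f k.+1) (M k) (M k.+1) (f (k - tau) + _) => u v x y z.
  move=> pS h1 h2 -> h3.
  have e : lam * (bet / 2 * (x + tau%:R * V k - S k)) =
    lam * (bet / 2 * x) + lam * (bet * tau%:R / 2 * V k) - lam * (bet / 2 * S k) by ring.
  have e2 : lam * (z - (v + bet / 2 * (x + tau%:R * V k - S k))) =
    lam * z - lam * v - lam * (bet / 2 * (x + tau%:R * V k - S k)) by ring.
  rewrite e2 e; lra.
rewrite mulrBl mul1r lerBrDr -lerBrDl mulrAC ler_pdivrMr// mulrC; lra.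
Qed.

Hypothesis pmin_lam : pmin <= lam.

(** Jumping back by [tau + 1] steps from [k + 1] lowers the quotient by one; the
    first [tau] steps only use monotonicity. *)
Lemma lyapunov_rate k : G k <= (1 - pmin / lam) ^+ (k %/ tau.+1) * G 0.
Proof.
have lam0 : 0 < lam by exact: lt_le_trans pmin_lam.
have rho0 : 0 <= 1 - pmin / lam by rewrite subr_ge0 ler_pdivrMr// mul1r.
elim/ltn_ind: k => -[|k] IH; first by rewrite div0n expr0 mul1r.
have [ktau|ktau] := ltnP k tau.
  by rewrite divn_small ?ltnS// expr0 mul1r lyapunov_nincr.
have -> : (k.+1 %/ tau.+1 = ((k - tau) %/ tau.+1).+1)%N.
  by rewrite -[in LHS](subnK ktau) -addnS divnDr ?dvdnn// divnn addn1.
rewrite exprS -mulrA; apply: le_trans (lyapunov_contraction k) _.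
by rewrite ler_wpM2l// IH// ltnS leq_subr.
Qed.

End lyapunov.

Section geometric.
Context (r : R) (N : nat) (r_ge0 : 0 <= r) (r_lt1 : r < 1).

(** Integer division is superadditive and [r <= 1]. *)
Lemma exprn_divnD k i :
  r ^+ ((k + i) %/ N.+1) <= r ^+ (k %/ N.+1) * r ^+ (i %/ N.+1).
Proof.
rewrite -exprD; apply: ler_wiXn2l => //; first exact: ltW.
by rewrite divnD// leq_addr.
Qed.

(** Group the terms by blocks of length [N + 1]. *)
Lemma sum_exprn_divn m : \sum_(0 <= i < m) r ^+ (i %/ N.+1) <= N.+1%:R / (1 - r).
Proof.
have r1 : 0 < 1 - r by rewrite subr_gt0.
have full j : \sum_(0 <= i < j * N.+1) r ^+ (i %/ N.+1) = N.+1%:R * \sum_(0 <= i < j) r ^+ i.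
  elim: j => [|j IH]; first by rewrite mul0n !big_nil mulr0.
  rewrite mulSn addnC (@big_cat_nat _ _ _ (j * N.+1)%N) ?leq_addr//= IH big_nat_recr//= mulrDr.
  congr (_ + _); rewrite -{1}(add0n (j * N.+1)%N) big_addn addKn.
  rewrite (eq_big_nat _ _ (F2 := fun=> r ^+ j)); last first.
    by move=> i /andP[_ iN]; rewrite addnC divnMDl// divn_small// addn0.
  by rewrite sumr_const_nat subn0 mulr_natl.
apply: (@le_trans _ _ (\sum_(0 <= i < m * N.+1) r ^+ (i %/ N.+1))).
  rewrite [leRHS](@big_cat_nat _ _ _ m)//= ?leq_pmulr// lerDl.
  by apply: sumr_ge0 => i _; exact: exprn_ge0.
rewrite full ler_pM2l// -[leRHS]mul1r ler_pdivlMr// mulrC.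
have -> : (1 - r) * \sum_(0 <= i < m) r ^+ i = 1 - r ^+ m.
  by rewrite big_mkord; have := subrX1 r m; lra.
by rewrite gerBl exprn_ge0.
Qed.

End geometric.

(** For [k < tau] the truncated subtraction shortens the sum, which thus always
    has at most [tau] terms. *)
Lemma sqr_sum_le (u : nat -> R) (tau k : nat) :
  (\sum_(k - tau <= h < k) u h) ^+ 2 <= tau%:R * \sum_(k - tau <= h < k) u h ^+ 2.
Proof.
have gen m l : (\sum_(m <= h < l) u h) ^+ 2 <= (l - m)%:R * \sum_(m <= h < l) u h ^+ 2.
  rewrite expr2 mulr_suml.
  apply: (@le_trans _ _ (\sum_(m <= i < l) \sum_(m <= j < l) (2^-1 * u i ^+ 2 + 2^-1 * u j ^+ 2))).
    apply: ler_sum => i _; rewrite mulr_sumr; apply: ler_sum => j _.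
    by have : 0 <= (u i - u j) ^+ 2 by [exact: sqr_ge0]; rewrite sqrrB; lra.
  rewrite (eq_bigr (fun i => (l - m)%:R * (2^-1 * u i ^+ 2) + \sum_(m <= j < l) 2^-1 * u j ^+ 2)).
    rewrite big_split /= -mulr_sumr sumr_const_nat -mulr_sumr -mulr_natl.
    by rewrite le_eqVlt; apply/orP; left; apply/eqP; field.
  by move=> i _; rewrite big_split /= sumr_const_nat mulr_natl.
apply: le_trans (gen _ _) _; apply: ler_wpM2r; first by apply: sumr_ge0 => h _; exact: sqr_ge0.
by rewrite ler_nat leq_subLR addnC -leq_subLR.
Qed.

End rates.

(** * Almost sure limits of summable paths *)

Section almost_sure_limit.
Context d (Omega : measurableType d) (R : realType) (P : probability Omega R).
Context (V : completeNormedModType R) (x : nat -> Omega -> V) (h : nat -> Omega -> R) (z0 : V).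
Hypotheses (x_meas : forall k (A : set V), measurable (x k @^-1` A))
  (h_meas : forall k, measurable_fun setT (h k)) (h_ge0 : forall k w, 0 <= h k w)
  (x_h : forall k w, `|x k.+1 w - x k w| <= h k w).

Definition tail_sum k w : \bar R := (\sum_(0 <= i <oo) (h (k + i) w)%:E)%E.

(** The event on which the limit is taken; off this event the tails are infinite,
    so that [dist_path_limit] holds for every [w]. *)
Definition summable_path : set Omega := [set w | (tail_sum 0 w < +oo)%E].

Definition path_limit w : V :=
  if pselect (summable_path w) then limn (x ^~ w) else z0.

Let hE_ge0 k w i : (0 <= (h (k + i) w)%:E)%E. Proof. by rewrite lee_fin. Qed.

Let partial_le k w m : ((\sum_(0 <= i < m) h (k + i) w)%:E <= tail_sum k w)%E.
Proof. by rewrite -sumEFin; apply: nneseries_lim_ge. Qed.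

Let tail_pinfty k w : ~ summable_path w -> tail_sum k w = +oo%E.
Proof.
move=> nS; have nS' : tail_sum 0 w = +oo%E.
  by apply/eqP; rewrite -leye_eq leNgt; apply/negP.
apply/eqP; rewrite -leye_eq -nS'.
have [tk|] := ltP (tail_sum k w) +oo%E; last by rewrite leye_eq => /eqP ->; rewrite leey.
have tk0 : (0 <= tail_sum k w)%E by apply: nneseries_ge0 => i _ _; exact: hE_ge0.
have tkf : tail_sum k w \is a fin_num by rewrite ge0_fin_numE.
suff : (tail_sum 0 w <= (\sum_(0 <= i < k) h i w)%:E + tail_sum k w)%E.
  by rewrite nS' leye_eq -(fineK tkf).
apply: lime_le; first by apply: is_cvg_nneseries => i _ _; exact: hE_ge0.
apply: nearW => m; rewrite sumEFin.
apply: (@le_trans _ _ (\sum_(0 <= i < k + m) h i w)%:E).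
  rewrite lee_fin [leRHS](@big_cat_nat _ _ _ m)//= ?leq_addl// lerDl.
  by apply: sumr_ge0.
rewrite (@big_cat_nat _ _ _ k)//= ?leq_addr// EFinD leeD2l//.
apply: le_trans (partial_le k w m).
rewrite lee_fin -{1}(add0n k) big_addn addKn.
by apply: ler_sum => i _; rewrite addnC.
Qed.

Section on_summable_path.
Context (w : Omega) (w_sum : summable_path w).

Let bound m : \sum_(0 <= i < m) h i w <= fine (tail_sum 0 w).
Proof.
have t0 : (0 <= tail_sum 0 w)%E by apply: nneseries_ge0 => i _ _; exact: hE_ge0.
by rewrite -lee_fin fineK ?ge0_fin_numE// (partial_le 0 w m).
Qed.

Lemma is_cvg_gap_series : cvgn (series (h ^~ w)).
Proof.
apply: nondecreasing_is_cvgn.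
  apply/nondecreasing_seqP => n; rewrite !seriesEnat /= big_nat_recr//=.
  by rewrite lerDl.
by exists (fine (tail_sum 0 w)) => _ [m _ <-]; rewrite seriesEnat; exact: bound.
Qed.

Lemma gap_cvg0 : h n w @[n --> \oo] --> 0.
Proof. exact: cvg_series_cvg_0 is_cvg_gap_series. Qed.

Lemma path_cvg : x n w @[n --> \oo] --> path_limit w.
Proof.
have -> : path_limit w = limn (x ^~ w) by rewrite /path_limit; case: pselect.
pose u n := x n.+1 w - x n w.
have cu : cvgn (series u).
  apply: normed_cvg; rewrite -[cvgn _]/(cvgn (series (fun n => `|u n|))).
  apply: nondecreasing_is_cvgn.
    apply/nondecreasing_seqP => n; rewrite !seriesEnat /= big_nat_recr//=.
    by rewrite lerDl.
  exists (fine (tail_sum 0 w)) => _ [m _ <-]; rewrite seriesEnat.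
  apply: le_trans (bound m); apply: ler_sum => i _; exact: x_h.
have -> : x ^~ w = (fun n => x 0 w + series u n).
  by apply/funext => n; rewrite seriesEnat /= telescope_sumr// addrC subrK.
by apply: is_cvgD => //; exact: is_cvg_cst.
Qed.

End on_summable_path.

Lemma dist_path_limit k w : (`|x k w - path_limit w|%:E <= tail_sum k w)%E.
Proof.
have [S|nS] := pselect (summable_path w); last by rewrite (tail_pinfty _ nS) leey.
have step m : (`|x k w - x (k + m) w|%:E <= tail_sum k w)%E.
  apply: le_trans (partial_le k w m); rewrite lee_fin distrC.
  elim: m => [|m IH]; first by rewrite addn0 subrr normr0 big_geq.
  rewrite addnS big_nat_recr//=.
  rewrite -(subrK (x (k + m) w) (x (k + m).+1 w)) -addrA (le_trans (ler_normD _ _))//.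
  by rewrite [leRHS]addrC lerD.
have c : `|x k w - x (k + m) w| @[m --> \oo] --> `|x k w - path_limit w|.
  apply: cvg_norm; apply: cvgB; first exact: cvg_cst.
  under eq_fun do rewrite addnC.
  have := path_cvg S; rewrite -(cvg_shiftn k) /=; exact.
have [tk|] := ltP (tail_sum k w) +oo%E; last by rewrite leye_eq => /eqP ->; rewrite leey.
have tk0 : (0 <= tail_sum k w)%E by apply: nneseries_ge0 => i _ _; exact: hE_ge0.
have tkf : tail_sum k w \is a fin_num by rewrite ge0_fin_numE.
rewrite -(fineK tkf) lee_fin -(cvg_lim _ c)//.
apply: limr_le; first by apply/cvg_ex; eexists; exact: c.
by apply: nearW => m; rewrite -lee_fin fineK.
Qed.

Let tail_meas k : measurable_fun setT (tail_sum k : Omega -> \bar R).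
Proof.
apply: (@ge0_emeasurable_sum _ _ R setT (fun i w => (h (k + i) w)%:E) xpredT) => // i _.
by apply/measurable_EFinP.
Qed.

Lemma measurable_summable_path : measurable summable_path.
Proof.
have -> : summable_path = ~` (setT `&` [set w | (+oo <= tail_sum 0 w)%E]).
  by rewrite setTI; apply/seteqP; split=> w /=; rewrite /summable_path /= ltNge => /negP.
by apply: measurableC; apply: emeasurable_fun_c_infty.
Qed.

(** Convergence along a path is detected by balls: the limit lies in an open set
    exactly when some ball of fixed radius around the late iterates does. *)
Lemma measurable_path_limit :
  measurable_fun setT (path_limit : Omega -> g_sigma_algebraType (@open V)).
Proof.
apply: (@measurability _ _ _ (g_sigma_algebraType (@open V)) _ _ (@open V)) => //.
move=> _ [U oU <-]; rewrite setTI.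
(* The iterates close to the end of the path keep a ball of fixed radius inside
   [U]; this involves countably many conditions on single iterates. *)
pose B n := [set v : V | ball v n.+1%:R^-1 `<=` U].
pose W := \bigcup_n \bigcup_N \bigcap_(k in [set k | (N <= k)%N]) (x k @^-1` B n).
have -> : path_limit @^-1` U =
    (summable_path `&` W) `|` (~` summable_path `&` [set _ | U z0]).
  apply/seteqP; split=> [w /= Uw|w].
    have [S|nS] := pselect (summable_path w); last first.
      by right; split=> //; move: Uw; rewrite /path_limit; case: pselect.
    left; split=> //; have /nbhs_ballP[e /= e0 eU] := open_nbhs_nbhs (conj oU Uw).
    have e2 : 0 < e / 2 by rewrite divr_gt0.
    have [n _ hn] := near_infty_natSinv_lt (PosNum e2).
    have /cvgrPdist_lt/(_ _ e2)[N _ hN] := path_cvg S.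
    exists n => //; exists N => // k /= Nk v; rewrite -ball_normE /= => kv.
    apply: eU; rewrite -ball_normE /= (splitr e).
    rewrite -(subrK (x k w) (path_limit w)) -addrA (le_lt_trans (ler_normD _ _))//.
    by apply: ltrD; [exact: hN|apply: lt_trans kv _; exact: hn (leqnn n)].
  move=> [[S [n _ [N _ hN]]]|[nS /= Uz]] /=; last first.
    by rewrite /path_limit; case: pselect.
  have n0 : (0 : R) < n.+1%:R^-1 by rewrite invr_gt0.
  have /cvgrPdist_lt/(_ _ n0)[M _ hM] := path_cvg S.
  have /= := hN (maxn N M) (leq_maxl _ _); apply.
  by rewrite -ball_normE /= distrC; apply: hM; exact: leq_maxr.
apply: measurableU; apply: measurableI => //.
- exact: measurable_summable_path.
- apply: bigcupT_measurable => n; apply: bigcupT_measurable => N.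
  by apply: bigcap_measurable => [|k _]; [exists N => /=|exact: x_meas].
- by apply: measurableC; exact: measurable_summable_path.
- have [Uz|nUz] := pselect (U z0).
    by have -> : [set _ : Omega | U z0] = setT by apply/seteqP; split.
  by have -> : [set _ : Omega | U z0] = set0 by apply/seteqP; split.
Qed.

Context (K r : R) (N : nat).
Hypotheses (r_ge0 : 0 <= r) (r_lt1 : r < 1) (K_ge0 : 0 <= K)
  (int_h : forall k, (\int[P]_w (h k w)%:E <= (K * r ^+ (k %/ N.+1))%:E)%E).

(** Monotone convergence, and the geometric bound on each term. *)
Lemma int_tail_sum k : (\int[P]_w tail_sum k w <=
  (K * (N.+1%:R / (1 - r)) * r ^+ (k %/ N.+1))%:E)%E.
Proof.
rewrite integral_nneseries//; last by move=> i; exact/measurable_EFinP.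
have int0 i : (0 <= \int[P]_w (h (k + i) w)%:E)%E.
  by apply: integral_ge0 => w _; exact: hE_ge0.
apply: lime_le; first by apply: is_cvg_nneseries.
apply: nearW => m.
apply: (@le_trans _ _ (\sum_(0 <= i < m) (K * (r ^+ (k %/ N.+1) * r ^+ (i %/ N.+1)))%:E)%E).
  apply: lee_sum => i _; apply: le_trans (int_h _) _.
  by rewrite lee_fin ler_wpM2l// exprn_divnD.
rewrite sumEFin lee_fin -mulr_sumr -mulr_sumr mulrAC -mulrA ler_wpM2l//.
by rewrite ler_wpM2l ?exprn_ge0// sum_exprn_divn.
Qed.

Lemma ae_summable_path : {ae P, forall w, summable_path w}.
Proof.
have it : P.-integrable setT (tail_sum 0).
  apply/integrableP; split => //.
  apply: (@le_lt_trans _ _ (\int[P]_w tail_sum 0 w)%E).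
    rewrite le_eqVlt; apply/orP; left; apply/eqP; apply: eq_integral => w _.
    by rewrite gee0_abs//; apply: nneseries_ge0 => i _ _; exact: hE_ge0.
  by apply: le_lt_trans (int_tail_sum 0) _; rewrite ltry.
apply: filterS (integrable_ae _ it) => // w /(_ I).
by rewrite fin_numElt => /andP[].
Qed.

(** The integral of a nonnegative function is a supremum over the simple
    functions below it, and this set grows with the function. *)
Lemma ge0_le_integral_pointwise (u v : Omega -> \bar R) :
  (forall w, (0 <= u w)%E) -> (forall w, (u w <= v w)%E) ->
  (\int[P]_w u w <= \int[P]_w v w)%E.
Proof.
move=> u0 uv; rewrite !ge0_integralTE//; last by move=> w; exact: le_trans (uv w).
by apply: ereal_sup_le => _ [s su <-]; exists s => // w; exact: le_trans (su w) (uv w).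
Qed.

Lemma int_dist_path_limit (N' : V -> R) (c : R) k : 0 <= c ->
  (forall v, 0 <= N' v) -> (forall v, N' v <= c * `|v|) ->
  (\int[P]_w (N' (x k w - path_limit w))%:E <=
    (c * (K * (N.+1%:R / (1 - r))) * r ^+ (k %/ N.+1))%:E)%E.
Proof.
move=> c0 N0 Nc; apply: (@le_trans _ _ (\int[P]_w (c%:E * tail_sum k w))%E).
  apply: ge0_le_integral_pointwise => w; first by rewrite lee_fin.
  apply: (@le_trans _ _ (c * `|x k w - path_limit w|)%:E); first by rewrite lee_fin.
  by rewrite EFinM lee_wpmul2l ?lee_fin// dist_path_limit.
rewrite ge0_integralZl//; last by move=> w _; apply: nneseries_ge0 => i _ _; exact: hE_ge0.
by rewrite -mulrA EFinM lee_wpmul2l ?lee_fin// int_tail_sum.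
Qed.

End almost_sure_limit.

(** * Constants of the stepsize condition *)

Section extrema.
Context (R : realType) (n : nat).
Implicit Type a : 'I_n.+1 -> R.

Lemma imax_ge a i : a i <= imax a.
Proof. exact: le_bigmax. Qed.

Lemma imin_le a i : imin a <= a i.
Proof. exact: bigmin_le. Qed.

Lemma imin_gt0 a : (forall i, 0 < a i) -> 0 < imin a.
Proof. by move=> a0; apply/bigmin_gtP; split=> // i _; exact: a0. Qed.

Lemma imax_gt0 a : (forall i, 0 < a i) -> 0 < imax a.
Proof. by move=> a0; exact: lt_le_trans (imax_ge a ord0). Qed.

Lemma imaxP a : exists i, imax a = a i.
Proof.
rewrite /imax; elim/big_ind: _ => [|u v [i ->] [j ->]|i _]; [by exists ord0| |by exists i].
by case: (leP (a i) (a j)) => _; [exists j|exists i].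
Qed.

End extrema.

Section step_constants.
Context (R : realType) (n : nat) (L gam p : 'I_n.+1 -> R) (Lres C delta : R) (tau : nat).
Hypotheses (Lres_gt0 : 0 < Lres) (L_ge0 : forall i, 0 <= L i) (p_gt0 : forall i, 0 < p i)
  (p_sum : \sum_i p i = 1) (gam_gt0 : forall i, 0 < gam i) (C_gt0 : 0 < C)
  (delta_def : delta = delta_step L gam p tau Lres) (delta_lt2 : delta < 2).

Local Notation pmin := (imin p).
Local Notation pmax := (imax p).
Local Notation gmax := (imax gam).

(** What the stepsize condition leaves in the descent inequality. *)
Definition margin := 1 - delta / 2.
(** The weight of the delay: the stepsize condition bounds its product with
    [2 gam i tau], and its square dominates [pmax Lres ^+ 2], which bounds the
    gradient error in the norm weighted by the probabilities. *)
Definition delay_rate := Lres * (pmax / Num.sqrt pmin).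

Let pmin_gt0 : 0 < pmin. Proof. exact: imin_gt0. Qed.
Let pmax_gt0 : 0 < pmax. Proof. exact: imax_gt0. Qed.
Let gmax_gt0 : 0 < gmax. Proof. exact: imax_gt0. Qed.
Let sq_gt0 : 0 < Num.sqrt pmin. Proof. by rewrite sqrtr_gt0. Qed.
Let sqE : Num.sqrt pmin ^+ 2 = pmin. Proof. by rewrite sqr_sqrtr// ltW. Qed.

Lemma imin_le_imax : pmin <= pmax.
Proof. exact: le_trans (imin_le p ord0) (imax_ge p ord0). Qed.

Lemma imin_le1 : pmin <= 1.
Proof.
rewrite -p_sum (bigD1 ord0)//= (le_trans (imin_le p ord0))// lerDl.
by apply: sumr_ge0 => i _; exact: ltW.
Qed.

Lemma margin_gt0 : 0 < margin.
Proof. by rewrite /margin; move: delta_lt2; lra. Qed.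

Lemma delay_rate_gt0 : 0 < delay_rate.
Proof. by rewrite mulr_gt0// divr_gt0. Qed.

Lemma step_small i : margin + L i * gam i / 2 + gam i * (delay_rate * tau%:R) <= 1.
Proof.
have : L i * gam i + 2 * gam i * tau%:R * Lres * (pmax / Num.sqrt pmin) <= delta.
  rewrite delta_def.
  exact: (imax_ge (fun i => L i * gam i + 2 * gam i * tau%:R * Lres * (pmax / Num.sqrt pmin)) i).
by rewrite /margin /delay_rate; lra.
Qed.

Lemma imax_p_delay_rate : pmax * Lres ^+ 2 <= delay_rate ^+ 2.
Proof.
have -> : delay_rate ^+ 2 = pmax * Lres ^+ 2 * (pmax / pmin).
  rewrite /delay_rate -[in RHS]sqE; field; by rewrite gt_eqF.
apply: ler_peMr; first by rewrite mulr_ge0 ?sqr_ge0// ltW.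
by rewrite ler_pdivlMr// mul1r imin_le_imax.
Qed.

Lemma kappa_max : kappa C delta = Num.max 1 (2 * C / (2 - delta)).
Proof.
have d0 : 0 < 2 - delta by rewrite subr_gt0.
rewrite /kappa; have [h|h] := leP (2 * C + delta - 2) 0.
  rewrite mul0r addr0 max_l// ler_pdivrMr// mul1r; lra.
rewrite max_r; last by rewrite ler_pdivlMr// mul1r; lra.
by field; rewrite gt_eqF.
Qed.

Lemma kappa_ge1 : 1 <= kappa C delta.
Proof. by rewrite kappa_max le_max lexx. Qed.

Lemma error_constant_le : C <= kappa C delta * margin.
Proof.
have h : 2 * C / (2 - delta) <= kappa C delta by rewrite kappa_max le_max lexx orbT.
apply: le_trans (ler_wpM2r (ltW margin_gt0) h).
have -> : 2 * C / (2 - delta) * margin = C; last by [].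
by rewrite /margin; field; rewrite gt_eqF// subr_gt0.
Qed.

Lemma theta_ge0 : 0 <= theta gam p tau Lres delta.
Proof.
have d0 : 0 < 2 - delta by rewrite subr_gt0.
rewrite /theta; apply: mulr_ge0; last by rewrite addr_ge0// divr_ge0 ?sqr_ge0// ltW.
by rewrite divr_ge0 ?(ltW d0)// mulr_ge0 ?(ltW gmax_gt0)// mulr_ge0// ltW.
Qed.

(** [theta] pays for the memory term, through [pmin <= pmax], and for the error
    of linearization at the delayed point, through [pmin <= 1]. *)
Lemma theta_margin : pmin * (tau%:R / 2 * (Lres + delay_rate)) * gmax <=
  theta gam p tau Lres delta * margin.
Proof.
have -> : theta gam p tau Lres delta * margin =
    (Lres * (pmax ^+ 2 / Num.sqrt pmin) + Lres) * (tau%:R / 2 * gmax).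
  by rewrite /theta /margin; field; rewrite !gt_eqF// subr_gt0.
have -> : pmin * (tau%:R / 2 * (Lres + delay_rate)) * gmax =
  (pmin * delay_rate + pmin * Lres) * (tau%:R / 2 * gmax) by ring.
apply: ler_wpM2r; first by rewrite mulr_ge0 ?divr_ge0// ltW.
apply: lerD; last by rewrite ger_pMl// imin_le1.
rewrite /delay_rate mulrCA ler_pM2l// mulrA ler_pM2r ?invr_gt0// expr2.
by rewrite ler_pM2r// imin_le_imax.
Qed.

Lemma theta_le : theta gam p tau Lres delta <=
  Num.sqrt pmin / (pmax * (2 - delta)) * (pmax ^+ 2 / Num.sqrt pmin + 1).
Proof.
have d0 : 0 < 2 - delta by rewrite subr_gt0.
rewrite /theta; apply: ler_wpM2r.
  by rewrite addr_ge0// divr_ge0 ?sqr_ge0// ltW.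
rewrite invfM mulrA; apply: ler_wpM2r; first by rewrite invr_ge0 ltW.
rewrite ler_pdivlMr//.
have [j ->] := imaxP gam.
have h := step_small j; have m0 := margin_gt0.
have Lg : 0 <= L j * gam j by rewrite mulr_ge0// ltW.
have {}h : gam j * (delay_rate * tau%:R) <= 1 by lra.
have -> : tau%:R * Lres * gam j * pmax = Num.sqrt pmin * (gam j * (delay_rate * tau%:R)).
  by rewrite /delay_rate; field; rewrite gt_eqF.
by rewrite ger_pMr.
Qed.

End step_constants.

(** * Lower semicontinuity of the objective *)

Section lower_semicontinuity.
Context (R : realType) (n : nat).

(** Approximating each [y i] from below at once excludes the value +oo, then lets
    the error tend to 0. *)
Lemma sume_le_approx (y : 'I_n.+1 -> \bar R) (B : R) : (forall i, y i != -oo%E) ->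
  (forall a : 'I_n.+1 -> R, (forall i, ((a i)%:E < y i)%E) -> \sum_i a i <= B) ->
  (\sum_i y i <= B%:E)%E.
Proof.
move=> yN aB; pose a0 i := if y i is r%:E then r - 1 else 0.
have a0y i : ((a0 i)%:E < y i)%E.
  rewrite /a0; case: (y i) (yN i) => [r| |]// _; last by rewrite ltry.
  by rewrite lte_fin ltrBlDr ltrDl.
have yfin i : y i \is a fin_num.
  rewrite fin_numE yN /=; apply/negP => /eqP yi.
  pose a j := if j == i then B - \sum_(j | j != i) a0 j + 1 else a0 j.
  have /aB : forall j, ((a j)%:E < y j)%E.
    by move=> j; rewrite /a; case: eqP => [->|_]; [rewrite yi ltry|exact: a0y].
  have E : \sum_(j | j != i) a j = \sum_(j | j != i) a0 j.
    by apply: eq_bigr => j /negPf ji; rewrite /a ji.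
  by rewrite (bigD1 i)//= {1}/a eqxx E; lra.
have -> : (\sum_i y i = (\sum_i fine (y i))%:E)%E.
  by rewrite -sumEFin; apply: eq_bigr => i _; rewrite fineK.
rewrite lee_fin; apply/ler_addgt0Pr => e e0.
pose e' := e / n.+1%:R; have e'0 : 0 < e' by rewrite divr_gt0.
have /aB : forall i, ((fine (y i) - e')%:E < y i)%E.
  by move=> i; rewrite -{2}(fineK (yfin i)) lte_fin ltrBlDr ltrDl.
rewrite sumrB sumr_const card_ord -(mulr_natr e') /e' divfK ?pnatr_eq0//; lra.
Qed.

Context (H : 'I_n.+1 -> hilbertType R) (f : direct_sum H -> R) (g : forall i, H i -> \bar R).
Arguments g : clear implicits.

(** Eventually [g i (u k i)] exceeds any real number below [g i (v i)], and [f] is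
    continuous. *)
Lemma objective_lsc (u : nat -> direct_sum H) (v : direct_sum H) (c : R) :
  (forall x : direct_sum H, differentiable f x) ->
  (forall i, eproper (g i)) -> (forall i, lower_semicontinuous (g i)) ->
  (forall k, in_dom g (u k)) ->
  u k @[k --> \oo] --> v -> objective f g (u k) @[k --> \oo] --> c ->
  ((f v)%:E + sep_sum g v <= c%:E)%E.
Proof.
move=> f_diff g_proper g_lsc udom uv uc.
have -> : c%:E = ((f v)%:E + (c - f v)%:E)%E by rewrite -EFinD addrC subrK.
rewrite leeD2l//; apply: sume_le_approx => [i|a ag].
  by have [gN _] := g_proper i.
have fc : f (u k) @[k --> \oo] --> f v.
  apply: (cvg_comp _ _ uv); exact: (differentiable_continuous (f_diff v)).
have dc : (objective f g (u k) - f (u k)) @[k --> \oo] --> c - f v by exact: cvgB.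
rewrite -(cvg_lim _ dc)//; apply: limr_ge; first by apply/cvg_ex; eexists; exact: dc.
have near_g i : \forall k \near \oo, ((a i)%:E < g i (u k i))%E.
  have [W Wv Wa] := g_lsc i (v i) (a i) (ag i).
  have uvi : u k i @[k --> \oo] --> v i.
    apply/cvgrPdist_lt => e e0; move/cvgrPdist_lt: uv => /(_ e e0).
    by apply: filterS => k vk; exact: (le_lt_trans (norm_coord_le (v - u k) i) vk).
  have near_W : \forall k \near \oo, W (u k i) by exact: uvi W Wv.
  by apply: filterS near_W => k; exact: Wa.
have near_all : \forall k \near \oo, forall i, ((a i)%:E < g i (u k i))%E.
  exact: filter_forall _ near_g.
apply: filterS near_all => k ak; rewrite /objective addrAC subrr add0r.
apply: ler_sum => i _; rewrite -lee_fin fineK ?(udom k i)//; exact: ltW (ak i).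
Qed.

End lower_semicontinuity.

Section expect_linear.
Context d (Omega : measurableType d) (R : realType) (P : probability Omega R).
Context (n : nat) (ik : nat -> {RV P >-> 'I_n.+1}).

Lemma expect_lin4 k (h1 h2 h3 h4 : Omega -> R) (b c e : R) :
  adapted ik k h1 -> adapted ik k h2 -> adapted ik k h3 -> adapted ik k h4 ->
  \int[P]_w (h1 w + b * h2 w + c * h3 w + e * h4 w) =
  \int[P]_w h1 w + b * (\int[P]_w h2 w) + c * (\int[P]_w h3 w) + e * (\int[P]_w h4 w).
Proof.
move=> a1 a2 a3 a4.
have z2 := adapted_comp (fun r => b * r) a2.
have z3 := adapted_comp (fun r => c * r) a3.
have z4 := adapted_comp (fun r => e * r) a4.
have s2 := adapted_comp2 +%R a1 z2.
have s3 := adapted_comp2 +%R s2 z3.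
rewrite (expectD s3 z4) (expectD s2 z3) (expectD a1 z2).
by rewrite (expectZ _ a2) (expectZ _ a3) (expectZ _ a4).
Qed.

End expect_linear.

(** * The asynchronous algorithm *)

Section async.
Context (R : realType) (n : nat) (H : 'I_n.+1 -> hilbertType R).
Context (f : direct_sum H -> R) (g : forall i, H i -> \bar R).
Arguments g : clear implicits.
Context (gam L : 'I_n.+1 -> R) (Lres : R).
Hypotheses (f_convex : convex_function [set: convex_lmodType (direct_sum H)] f)
  (f_diff : forall x : direct_sum H, differentiable f x)
  (g_proper : forall i, eproper (g i)) (g_convex : forall i, econvex (g i))
  (g_lsc : forall i, lower_semicontinuous (g i)) (gam_gt0 : forall i, 0 < gam i)
  (Lres_gt0 : 0 < Lres) (L_ge0 : forall i, 0 <= L i)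
  (grad_lip : forall (x : direct_sum H) i,
     Lres.-lipschitz (fun u : H i => grad f (set_block x u)))
  (grad_block_lip : forall (x : direct_sum H) i,
     (L i).-lipschitz (fun u : H i => grad f (set_block x u) i)).
Context d (Omega : measurableType d) (P : probability Omega R).
Context (ik : nat -> {RV P >-> 'I_n.+1}) (p : 'I_n.+1 -> R).
Hypotheses (p_gt0 : forall i, 0 < p i) (ik_iid : iid_with_law ik p).
Context (tau : nat) (dl : nat -> 'I_n.+1 -> nat) (x0 : direct_sum H)
  (x : nat -> Omega -> direct_sum H).
Hypotheses (dl_le : forall k i, (dl k i <= minn k tau)%N)
  (x0_dom : in_dom g x0)
  (x_alg : forall w, async_fb f g gam dl x0 (fun k => ik k w) (fun k => x k w)).

Local Notation E h := (Rintegral P setT h).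

Definition delayed k w : direct_sum H := delay_point (fun j => x j w) dl k.

Lemma async_step k w : x k.+1 w = fb_step f g gam (x k w) (delayed k w) (ik k w).
Proof.
have [_ xS] := x_alg w; apply/functional_extensionality_dep => i; rewrite xS.
have [->|ik_i] := eqVneq i (ik k w); last by rewrite /fb_step set_block_neq.
by rewrite /fb_step set_blockE /fb_dir -lock [RHS]addrC subrK.
Qed.

Lemma async_in_dom k w : in_dom g (x k w).
Proof.
elim: k => [|k IH]; first by have [-> _] := x_alg w.
rewrite async_step; exact: in_dom_fb_step.
Qed.

Lemma adapted_async k : adapted ik k (x k).
Proof.
elim/ltn_ind: k => -[|k] IH w w' e.
  by have [-> _] := x_alg w; have [-> _] := x_alg w'.
have xj j : (j <= k)%N -> x j w = x j w'.
  by move=> jk; apply: (adapted_le (leqW jk) (IH j _)) e; rewrite ltnS.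
have yE : delayed k w = delayed k w'.
  by apply/functional_extensionality_dep => i; rewrite /delayed /delay_point xj ?leq_subr.
rewrite !async_step yE (xj k)//.
by move/histP: e => ->.
Qed.

Lemma adapted_delayed k : adapted ik k (delayed k).
Proof.
move=> w w' e; apply/functional_extensionality_dep => i; rewrite /delayed /delay_point.
by rewrite (adapted_le (leq_subr (dl k i) k) (@adapted_async _) e).
Qed.

Definition delayed_dir k w i : H i := fb_dir f g gam (x k w) (delayed k w) i.

Lemma adapted_delayed_dir (T : Type) (F : direct_sum H -> T) k :
  adapted ik k (fun w => F (fun i => delayed_dir k w i)).
Proof.
move=> w w' e; congr F; apply/functional_extensionality_dep => i.
by rewrite /delayed_dir (adapted_async e) (adapted_delayed e).
Qed.

Definition displacement k w : R := `|x k.+1 w - x k w|.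

Lemma adapted_displacement k : adapted ik k.+1 (displacement k).
Proof.
move=> w w' e; rewrite /displacement (@adapted_async k.+1 _ _ e).
by rewrite (adapted_le (leqnSn k) (@adapted_async k) e).
Qed.

Lemma displacementE k w : displacement k w = `|delayed_dir k w (ik k w)|.
Proof.
rewrite /displacement async_step /delayed_dir; set D := fb_dir _ _ _ _ _ _.
have -> : fb_step f g gam (x k w) (delayed k w) (ik k w) - x k w = set_block 0 D.
  have := set_blockD (x k w) 1 D; rewrite !scale1r /fb_step -/D => <-.
  by rewrite addrC addKr.
apply/eqP; rewrite -(@eqrXn2 _ 2)//; apply/eqP.
by rewrite -!inner_normE inner_set_block set_blockE.
Qed.

(** One step moves a single block. *)
Lemma sum_coord_displacement k w : \sum_i `|x k.+1 w i - x k w i| = displacement k w.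
Proof.
rewrite displacementE async_step (bigD1 (ik k w))//= big1.
  by rewrite addr0 /fb_step set_blockE addrC addKr.
by move=> i iki; rewrite /fb_step set_block_neq// subrr normr0.
Qed.

Definition window k w : R := \sum_(k - tau <= h < k) displacement h w ^+ 2.

Lemma adapted_window k : adapted ik k (window k).
Proof.
move=> w w' e; apply: eq_big_nat => h /andP[_ hk].
by rewrite (adapted_le hk (@adapted_displacement h) e).
Qed.

(** Telescope each block from its delayed value to its current one; since a step
    moves a single block, the sum over the blocks is at most the length of the
    last [tau] steps. *)
Lemma delayed_dist k w :
  (\sum_i `|x k w i - delayed k w i|) ^+ 2 <= tau%:R * window k w.
Proof.
apply: le_trans (sqr_sum_le (displacement ^~ w) tau k).
have displacement0 : 0 <= \sum_(k - tau <= h < k) displacement h w.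
  by apply: sumr_ge0 => h _; exact: normr_ge0.
rewrite ler_pXn2r ?nnegrE ?displacement0 ?sumr_ge0//.
under [leRHS]eq_bigr => h _ do rewrite -sum_coord_displacement.
rewrite exchange_big /=; apply: ler_sum => i _.
have dk : (dl k i <= k)%N by apply: leq_trans (dl_le k i) _; exact: geq_minl.
have dtau : (dl k i <= tau)%N by apply: leq_trans (dl_le k i) _; exact: geq_minr.
rewrite /delayed /delay_point.
have -> : x k w i - x (k - dl k i)%N w i =
    \sum_(k - dl k i <= h < k) (x h.+1 w i - x h w i).
  by rewrite (telescope_sumr (fun h => x h w i))// leq_subr.
apply: le_trans (ler_norm_sum _ _ _) _.
rewrite [leRHS](@big_cat_nat _ _ _ (k - dl k i)%N) ?leq_subr ?leq_sub2l//=.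
by rewrite lerDr sumr_ge0.
Qed.

(** A displacement enters with weight [tau] and loses one unit at each later
    step, until it leaves the window; [memory_next] is this accounting. *)
Definition memory k w : R := \sum_(0 <= h < k) (tau.+1 + h - k)%:R * displacement h w ^+ 2.

Lemma adapted_memory k : adapted ik k (memory k).
Proof.
move=> w w' e; apply: eq_big_nat => h /andP[_ hk].
by rewrite (adapted_le hk (@adapted_displacement h) e).
Qed.

Lemma memory_ge0 k w : 0 <= memory k w.
Proof. by apply: sumr_ge0 => h _; rewrite mulr_ge0// sqr_ge0. Qed.

Let split_window k (F : nat -> R) : \sum_(0 <= h < k) F h =
  \sum_(0 <= h < k - tau) F h + \sum_(k - tau <= h < k) F h.
Proof. by rewrite (@big_cat_nat _ _ _ (k - tau)%N) ?leq_subr. Qed.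

Lemma memory_le k w : memory k w <= tau%:R * window k w.
Proof.
rewrite /memory split_window big_nat_cond big1 ?add0r; last first.
  move=> h /andP[/andP[_ hk] _]; have -> : (tau.+1 + h - k = 0)%N; last by rewrite mul0r.
  by apply/eqP; rewrite subn_eq0 addSn -ltn_subRL.
rewrite mulr_sumr big_nat_cond [leRHS]big_nat_cond; apply: ler_sum => h.
move=> /andP[/andP[_ hk] _]; rewrite ler_wpM2r ?sqr_ge0// ler_nat.
by rewrite leq_subLR addSn -addnS addnC leq_add2r.
Qed.

Lemma memory_next k w :
  memory k.+1 w = memory k w + tau%:R * displacement k w ^+ 2 - window k w.
Proof.
rewrite /memory big_nat_recr//= addSn subSS addnK.
rewrite (split_window k (fun h => (tau.+1 + h - k.+1)%:R * displacement h w ^+ 2)).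
rewrite (split_window k (fun h => (tau.+1 + h - k)%:R * displacement h w ^+ 2)).
have old j (c : nat -> nat -> nat) : (forall h, (h < k - tau)%N -> c j h = 0%N) ->
    \sum_(0 <= h < k - tau) (c j h)%:R * displacement h w ^+ 2 = 0.
  by move=> c0; rewrite big_nat big1// => h /andP[_ /c0 ->]; rewrite mul0r.
rewrite (old k.+1 (fun j h => tau.+1 + h - j)%N); last first.
  by move=> h; rewrite ltn_subRL => hk; apply/eqP; rewrite subn_eq0 addSn ltnS ltnW.
rewrite (old k (fun j h => tau.+1 + h - j)%N); last first.
  by move=> h; rewrite ltn_subRL => hk; apply/eqP; rewrite subn_eq0 addSn.
rewrite !add0r addrAC; congr (_ + _); rewrite /window -sumrB.
rewrite big_nat [RHS]big_nat; apply: eq_bigr => h /andP[hk _].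
rewrite addSn subSS subSn; last by rewrite -leq_subLR.
by rewrite -[(tau + h - k).+1]addn1 natrD mulrDl mul1r addrK.
Qed.

Lemma memory0 w : memory 0 w = 0.
Proof. by rewrite /memory big_geq. Qed.

Context (C delta : R).
Hypotheses (C_gt0 : 0 < C) (delta_def : delta = delta_step L gam p tau Lres)
  (delta_lt2 : delta < 2).
Context (Fs : R) (S : set (direct_sum H)).
Hypotheses (S_neq0 : S !=set0)
  (S_min : forall z, S z -> in_dom g z /\ objective f g z = Fs)
  (Fs_le : forall z, in_dom g z -> Fs <= objective f g z)
  (error_bound : forall k w,
     wdist gam (x k w) S <= C * wnorm gam (fun i => fb_dir f g gam (x k w) (x k w) i)).

Local Notation eta := (margin delta).
Local Notation bet := (delay_rate p Lres).
Local Notation gmax := (imax gam).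
Local Notation lam := (kappa C delta + theta gam p tau Lres delta).
Local Notation rho := (1 - imin p / lam).

Let p_sum : \sum_i p i = 1. Proof. exact: sum_law ik_iid. Qed.

Definition gap k w := objective f g (x k w) - Fs.
Definition mean_wsqr_dir k w := \sum_i p i / gam i * `|delayed_dir k w i| ^+ 2.
Definition mean_sqr_dir k w := \sum_i p i * `|delayed_dir k w i| ^+ 2.

Lemma gap_ge0 k w : 0 <= gap k w.
Proof. by rewrite subr_ge0; apply: Fs_le; exact: async_in_dom. Qed.

Lemma adapted_gap k : adapted ik k (gap k).
Proof. by move=> w w' e; rewrite /gap (adapted_async e). Qed.

Lemma adapted_mean_wsqr_dir k : adapted ik k (mean_wsqr_dir k).
Proof.
exact: (adapted_delayed_dir (fun D : direct_sum H => \sum_i p i / gam i * `|D i| ^+ 2)).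
Qed.

Lemma adapted_mean_sqr_dir k : adapted ik k (mean_sqr_dir k).
Proof. exact: (adapted_delayed_dir (fun D : direct_sum H => \sum_i p i * `|D i| ^+ 2)). Qed.

Let next_gap k w i : R := objective f g (fb_step f g gam (x k w) (delayed k w) i) - Fs.

Let adapted_next_gap k i : adapted ik k (next_gap k ^~ i).
Proof. by move=> w w' e; rewrite /next_gap (adapted_async e) (adapted_delayed e). Qed.

Let adapted_mean_next_gap k : adapted ik k (fun w => \sum_i p i * next_gap k w i).
Proof. by move=> w w' e; apply: eq_bigr => i _; rewrite (@adapted_next_gap k i _ _ e). Qed.

Let expect_next_gap k : E (gap k.+1) = E (fun w => \sum_i p i * next_gap k w i).
Proof.
rewrite -(expect_next ik_iid (k := k) (A := next_gap k)); last exact: adapted_next_gap.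
by apply: eq_expect => w; rewrite /gap async_step.
Qed.

Let expect_sqr_displacement k : E (fun w => displacement k w ^+ 2) = E (mean_sqr_dir k).
Proof.
pose A w i := `|delayed_dir k w i| ^+ 2.
rewrite -[E (mean_sqr_dir k)]/(E (fun w => \sum_i p i * A w i)).
rewrite -(expect_next ik_iid (k := k) (A := A)).
  by apply: eq_expect => w; rewrite displacementE.
by move=> i; exact: (adapted_delayed_dir (fun D : direct_sum H => `|D i| ^+ 2)).
Qed.

Let mean_gap k w : \sum_i p i * next_gap k w i =
  \sum_i p i * objective f g (fb_step f g gam (x k w) (delayed k w) i) - Fs.
Proof.
rewrite -[in RHS](mul1r Fs) -p_sum mulr_suml -sumrB.
by apply: eq_bigr => i _; rewrite mulrBr.
Qed.

Let window_ge0 k w : 0 <= window k w.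
Proof. by apply: sumr_ge0 => h _; exact: sqr_ge0. Qed.

Lemma expect_decrease k : E (gap k.+1) <= E (gap k) - eta * E (mean_wsqr_dir k)
  - bet * tau%:R / 2 * E (mean_sqr_dir k) + bet / 2 * E (window k).
Proof.
have aR := @adapted_gap k; have aQ := @adapted_mean_wsqr_dir k.
have aV := @adapted_mean_sqr_dir k; have aS := @adapted_window k.
rewrite expect_next_gap -(mulNr eta) -(mulNr (bet * tau%:R / 2)) -(expect_lin4 _ _ _ aR aQ aV aS).
apply: (expect_le (k := k)) => [|w w' e|w].
- exact: adapted_mean_next_gap.
- by rewrite (aR _ _ e) (aQ _ _ e) (aV _ _ e) (aS _ _ e).
rewrite mean_gap.
have := expected_decrease f_diff g_proper g_convex g_lsc gam_gt0 grad_lip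
  grad_block_lip p_sum (imin_gt0 p_gt0) (imin_le p) (imax_ge p)
  (delay_rate_gt0 Lres_gt0 p_gt0) (imax_p_delay_rate Lres p_gt0) L_ge0
  (margin_gt0 delta_lt2) Lres_gt0 (step_small delta_def)
  (@async_in_dom k w) (window_ge0 k w) (delayed_dist k w).
rewrite /gap /mean_wsqr_dir /mean_sqr_dir /delayed_dir; lra.
Qed.

Lemma expect_gap_decrease k : lam * E (gap k.+1) <= lam * E (gap k)
  - imin p * E (gap k) + imin p * (Lres / 2 * (tau%:R * E (window k)))
  - lam * (bet * tau%:R / 2 * E (mean_sqr_dir k)) + lam * (bet / 2 * E (window k)).
Proof.
have aR := @adapted_gap k; have aV := @adapted_mean_sqr_dir k; have aS := @adapted_window k.
have -> : lam * E (gap k) - imin p * E (gap k)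
    + imin p * (Lres / 2 * (tau%:R * E (window k)))
    - lam * (bet * tau%:R / 2 * E (mean_sqr_dir k)) + lam * (bet / 2 * E (window k)) =
  E (fun=> 0) + (lam - imin p) * E (gap k) + (- (lam * (bet * tau%:R / 2))) * E (mean_sqr_dir k)
    + (imin p * (Lres / 2 * tau%:R) + lam * (bet / 2)) * E (window k).
  by rewrite expect_cst; ring.
have a0 : adapted ik k (fun=> 0 : R) by [].
rewrite expect_next_gap -(expect_lin4 _ _ _ a0 aR aV aS).
rewrite -(expectZ _ (@adapted_mean_next_gap k)).
apply: (expect_le (k := k)) => [|w w' e|w].
- exact: (adapted_comp (fun r => lam * r) (@adapted_mean_next_gap k)).
- by rewrite (aR _ _ e) (aV _ _ e) (aS _ _ e).
rewrite mean_gap.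
have := expected_gap_decrease f_convex f_diff g_proper g_convex g_lsc gam_gt0 grad_lip
  grad_block_lip p_sum (imin_gt0 p_gt0) (imin_le p) (imax_ge p)
  (delay_rate_gt0 Lres_gt0 p_gt0) (imax_p_delay_rate Lres p_gt0) L_ge0
  (margin_gt0 delta_lt2) Lres_gt0 (step_small delta_def)
  (@async_in_dom k w) (window_ge0 k w) (delayed_dist k w)
  (lam := lam) _ (ltW C_gt0) _ S_neq0 S_min (error_bound k w).
have th0 := theta_ge0 p tau Lres_gt0 gam_gt0 delta_lt2.
have k1 := kappa_ge1 C delta_lt2.
have Ck := error_constant_le C delta_lt2.
have Clam : C <= lam * eta.
  apply: le_trans Ck _; rewrite ler_wpM2r ?(ltW (margin_gt0 delta_lt2))//.
  by rewrite lerDl.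
have lam1 : 1 <= lam by apply: le_trans k1 _; rewrite lerDl.
move=> /(_ lam1 Clam).
rewrite /gap /mean_sqr_dir /delayed_dir; lra.
Qed.

Let adapted_sqr_displacement k : adapted ik k.+1 (fun w => displacement k w ^+ 2).
Proof. exact: (adapted_comp (fun r => r ^+ 2) (@adapted_displacement k)). Qed.

Let expect_window k : E (window k) = \sum_(k - tau <= h < k) E (mean_sqr_dir h).
Proof.
pose F h := if (h < k)%N then (fun w => displacement h w ^+ 2) else (fun=> 0).
have aF h : adapted ik k (F h).
  by rewrite /F; case: ifP => // hk; exact: adapted_le (@adapted_sqr_displacement h).
have -> : E (window k) = E (fun w => \sum_(k - tau <= h < k) F h w).
  by apply: eq_expect => w; apply: eq_big_nat => h /andP[_ hk]; rewrite /F hk.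
rewrite (expect_sum _ aF); apply: eq_big_nat => h /andP[_ hk].
by rewrite /F hk expect_sqr_displacement.
Qed.

Let expect_memory_next k : E (memory k.+1) =
  E (memory k) + tau%:R * E (mean_sqr_dir k) - E (window k).
Proof.
have aM := adapted_le (leqnSn k) (@adapted_memory k).
have aS := adapted_le (leqnSn k) (@adapted_window k).
have a0 : adapted ik k.+1 (fun=> 0 : R) by [].
have -> : E (memory k) + tau%:R * E (mean_sqr_dir k) - E (window k) =
    E (memory k) + tau%:R * E (fun w => displacement k w ^+ 2) + -1 * E (window k)
    + 0 * E (fun=> 0) by rewrite expect_sqr_displacement; ring.
rewrite -(expect_lin4 _ _ _ aM (@adapted_sqr_displacement k) aS a0).
by apply: eq_expect => w; rewrite memory_next; ring.
Qed.

Let expect_mean_sqr_dir_le k : E (mean_sqr_dir k) <= gmax * E (mean_wsqr_dir k).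
Proof.
rewrite -(expectZ _ (@adapted_mean_wsqr_dir k)).
apply: (expect_le (k := k)); first exact: adapted_mean_sqr_dir.
  exact: (adapted_comp (fun r => gmax * r) (@adapted_mean_wsqr_dir k)).
move=> w; rewrite mulr_sumr; apply: ler_sum => i _.
rewrite mulrA; apply: ler_wpM2r; first exact: sqr_ge0.
rewrite mulrCA -{1}(mulr1 (p i)) ler_pM2l// ler_pdivlMr// mul1r.
exact: imax_ge.
Qed.

Let expect_memory_le k : E (memory k) <= tau%:R * E (window k).
Proof.
rewrite -(expectZ _ (@adapted_window k)); apply: (expect_le (k := k)).
- exact: adapted_memory.
- exact: (adapted_comp (fun r => tau%:R * r) (@adapted_window k)).
- exact: memory_le.
Qed.

Local Notation G := (lyapunov (fun k => E (gap k)) (fun k => E (memory k)) bet).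

Let gmax_gt0 : 0 < gmax. Proof. exact: imax_gt0. Qed.

Let expect_memory0 : E (memory 0) = 0.
Proof. by rewrite -[RHS](expect_cst P); apply: eq_expect => w; exact: memory0. Qed.

Let expect_gap_ge0 k : 0 <= E (gap k).
Proof. by apply: expect_ge0 => w; exact: gap_ge0. Qed.

Let expect_mean_wsqr_dir_ge0 k : 0 <= E (mean_wsqr_dir k).
Proof.
apply: expect_ge0 => w; apply: sumr_ge0 => i _.
by rewrite mulr_ge0 ?sqr_ge0// divr_ge0// ltW.
Qed.

Let expect_memory_ge0 k : 0 <= E (memory k).
Proof. by apply: expect_ge0 => w; exact: memory_ge0. Qed.

Let bet_gt0 : 0 < bet. Proof. exact: delay_rate_gt0. Qed.

Let lam_ge1 : 1 <= lam.
Proof.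
apply: le_trans (kappa_ge1 C delta_lt2) _; rewrite lerDl.
exact: theta_ge0.
Qed.

Let pmin_lam : imin p <= lam.
Proof. by apply: le_trans lam_ge1; exact: imin_le1. Qed.

Let G0 : G 0 = E (gap 0).
Proof. by rewrite /lyapunov expect_memory0 mulr0 addr0. Qed.

Lemma rho_ge0 : 0 <= rho.
Proof.
have lam0 : 0 < lam by exact: lt_le_trans lam_ge1.
by rewrite subr_ge0 ler_pdivrMr// mul1r.
Qed.

Lemma rho_lt1 : rho < 1.
Proof.
have lam0 : 0 < lam by exact: lt_le_trans lam_ge1.
by rewrite gtrBl divr_gt0// imin_gt0.
Qed.

Lemma lyapunov_gap_rate k : G k <= rho ^+ (k %/ tau.+1) * E (gap 0).
Proof.
rewrite -G0; apply: (@lyapunov_rate _ tau _ (fun k => E (mean_wsqr_dir k))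
  (fun k => E (mean_sqr_dir k)) (fun k => E (window k)) _ _
  (theta gam p tau Lres delta) _ (margin delta) _ Lres gmax) => //.
- by rewrite addrK; exact: kappa_ge1.
- exact: imin_gt0.
- exact: imin_le1.
- exact: margin_gt0.
- exact: ltW.
- exact: ltW.
- exact: theta_ge0.
- exact: theta_margin.
- by move=> k'; exact: expect_decrease.
- by move=> k'; exact: expect_gap_decrease.
Qed.

Lemma expect_gap_rate k : E (gap k) <= rho ^+ (k %/ tau.+1) * E (gap 0).
Proof.
apply: le_trans (lyapunov_gap_rate k).
by apply: lyapunov_ge => //; exact: ltW.
Qed.

Lemma expect_sqr_displacement_rate k : E (fun w => displacement k w ^+ 2) <=
  gmax / eta * E (gap 0) * rho ^+ (k %/ tau.+1).
Proof.
have eta0 := margin_gt0 delta_lt2.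
have c0 : 0 <= gmax / eta by rewrite divr_ge0// ltW.
rewrite -mulrA [E (gap 0) * _]mulrC; apply: le_trans (ler_wpM2l c0 (lyapunov_gap_rate k)).
rewrite expect_sqr_displacement; apply: le_trans (expect_mean_sqr_dir_le k) _.
rewrite -mulrA ler_pM2l// ler_pdivlMl//.
have := @lyapunov_decrease _ tau _ (fun k => E (mean_wsqr_dir k)) (fun k => E (mean_sqr_dir k))
  (fun k => E (window k)) _ (margin delta) bet expect_memory_next expect_decrease k.
move=> /le_trans; apply; rewrite gerBl.
exact: (@lyapunov_ge0 _ _ _ bet (ltW bet_gt0) expect_gap_ge0 expect_memory_ge0).
Qed.

Local Notation r := (Num.sqrt rho).

Let r_ge0 : 0 <= r. Proof. exact: sqrtr_ge0. Qed.

Let r_sqr : r ^+ 2 = rho. Proof. by rewrite sqr_sqrtr// rho_ge0. Qed.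

Let r_lt1 : r < 1.
Proof. by rewrite -[X in _ < X]sqrtr1 ltr_sqrt// rho_lt1. Qed.

Let rho_r m : rho ^+ m = r ^+ m * r ^+ m.
Proof. by rewrite -{1}r_sqr -exprM mul2n -addnn exprD. Qed.

Definition path_gap k w := displacement k w + gap k w.

Let path_gap_ge0 k w : 0 <= path_gap k w.
Proof. by rewrite addr_ge0 ?gap_ge0// normr_ge0. Qed.

Let adapted_path_gap k : adapted ik k.+1 (path_gap k).
Proof. exact: adapted_comp2 (@adapted_displacement k) (adapted_le (leqnSn k) (@adapted_gap k)). Qed.

Definition path_rate_cst := Num.sqrt (gmax / eta * E (gap 0)) + E (gap 0).

Let A_ge0 : 0 <= gmax / eta * E (gap 0).
Proof.
by rewrite mulr_ge0// divr_ge0 ?(ltW gmax_gt0)// ltW// margin_gt0.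
Qed.

Let path_rate_cst_ge0 : 0 <= path_rate_cst.
Proof. by rewrite addr_ge0// sqrtr_ge0. Qed.

Let int_path_gap k : (\int[P]_w (path_gap k w)%:E <=
  (path_rate_cst * r ^+ (k %/ tau.+1))%:E)%E.
Proof.
rewrite (EFin_expect (@adapted_path_gap k)) lee_fin.
rewrite (expectD (@adapted_displacement k) (adapted_le (leqnSn k) (@adapted_gap k))).
rewrite mulrDl; apply: lerD.
  have rk0 : 0 <= r ^+ (k %/ tau.+1) by exact: exprn_ge0.
  rewrite -(@ler_pXn2r _ 2)// ?nnegrE ?mulr_ge0 ?sqrtr_ge0//; last first.
    by apply: expect_ge0 => w; exact: normr_ge0.
  apply: le_trans (sqr_expect_le (@adapted_displacement k)) _.
  apply: le_trans (expect_sqr_displacement_rate k) _.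
  by rewrite exprMn sqr_sqrtr// rho_r -expr2.
apply: le_trans (expect_gap_rate k) _; rewrite mulrC ler_wpM2l// rho_r.
by apply: ler_piMr; rewrite ?exprn_ge0// exprn_ile1// ltW.
Qed.

Context (z0 : direct_sum H) (S_z0 : S z0).

Definition async_limit : Omega -> direct_sum H := path_limit x path_gap z0.

Let x_meas k (Y : set (direct_sum H)) : measurable (x k @^-1` Y).
Proof. exact: measurable_adapted (@adapted_async k). Qed.

Let h_meas k : measurable_fun setT (path_gap k).
Proof. exact: measurable_fun_adapted (@adapted_path_gap k). Qed.

Let displacement_le k w : `|x k.+1 w - x k w| <= path_gap k w.
Proof. by rewrite lerDl gap_ge0. Qed.

Lemma measurable_async_limit : measurable_fun setT
  (async_limit : Omega -> g_sigma_algebraType (@open (direct_sum H))).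
Proof. by apply: measurable_path_limit. Qed.

Lemma async_limit_min w : ((f (async_limit w))%:E + sep_sum g (async_limit w) <= Fs%:E)%E.
Proof.
have [Sw|nSw] := pselect (summable_path path_gap w); last first.
  have -> : async_limit w = z0 by rewrite /async_limit /path_limit; case: pselect.
  by have [domz <-] := S_min S_z0; rewrite sep_sum_fin.
apply: (objective_lsc f_diff g_proper g_lsc (u := x ^~ w)).
- by move=> k; exact: async_in_dom.
- by apply: path_cvg.
have gap0 : gap k w @[k --> \oo] --> 0.
  apply: (squeeze_cvgr (f := fun=> 0) (h := path_gap ^~ w)).
  - by apply: nearW => k; rewrite gap_ge0/= lerDr normr_ge0.
  - exact: cvg_cst.
  - by apply: gap_cvg0.
have -> : (fun k => objective f g (x k w)) = (fun k => gap k w + Fs).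
  by apply/funext => k; rewrite subrK.
by rewrite -[X in _ --> X]add0r; apply: cvgD => //; exact: cvg_cst.
Qed.

Lemma async_limit_cvg : {ae P, forall w, x k w @[k --> \oo] --> async_limit w}.
Proof.
have := ae_summable_path h_meas path_gap_ge0 r_ge0 r_lt1 path_rate_cst_ge0 int_path_gap.
by apply: filterS => w Sw; apply: path_cvg.
Qed.

(** The weighted norm is at most a constant times the norm, for which the
    remaining length of the path bounds the distance to the limit. *)
Lemma async_limit_rate : exists c : R, forall k,
  (\int[P]_w (wnorm gam (x k w - async_limit w))%:E <= (c * r ^+ (k %/ tau.+1))%:E)%E.
Proof.
pose c := Num.sqrt (\sum_i (gam i)^-1).
exists (c * (path_rate_cst * (tau.+1%:R / (1 - r)))) => k.
apply: int_dist_path_limit => //; first exact: sqrtr_ge0.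
  by move=> v; exact: wnorm_ge0.
move=> v; have c0 : 0 <= \sum_i (gam i)^-1.
  by apply: sumr_ge0 => i _; rewrite invr_ge0 ltW.
rewrite -(@ler_pXn2r _ 2)// ?nnegrE ?mulr_ge0 ?wnorm_ge0 ?sqrtr_ge0//.
rewrite sqr_wnorm// exprMn sqr_sqrtr// mulr_suml; apply: ler_sum => i _.
rewrite ler_wpM2l ?invr_ge0 ?(ltW (gam_gt0 i))//.
by rewrite ler_pXn2r ?nnegrE// norm_coord_le.
Qed.

End async.

(** * Convergence rate *)

Theorem theorem4p2 (R : realType) (n : nat) (H : 'I_n.+1 -> hilbertType R)
  (H_separable : forall i, separable (H i))
  (f : direct_sum H -> R)
  (f_convex : convex_function [set: convex_lmodType (direct_sum H)] f)
  (f_diff : forall x : direct_sum H, differentiable f x)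
  (g : forall i, H i -> \bar R)
  (g_proper : forall i, eproper (g i))
  (g_convex : forall i, econvex (g i))
  (g_lsc : forall i, lower_semicontinuous (g i))
  (Lres : R) (L : 'I_n.+1 -> R)
  (Lres_gt0 : 0 < Lres)
  (L_ge0 : forall i, 0 <= L i)
  (grad_lip : forall (x : direct_sum H) i,
     Lres.-lipschitz (fun u : H i => grad f (set_block x u)))
  (grad_block_lip : forall (x : direct_sum H) i,
     (L i).-lipschitz (fun u : H i => grad f (set_block x u) i))
  (L_le_Lres : imax L <= Lres)
  (F : direct_sum H -> \bar R)
  (F_def : F = fun x => ((f x)%:E + sep_sum g x)%E)
  (F_attains : argmin F !=set0)
  (Fstar : \bar R)
  (Fstar_def : Fstar = ereal_inf (range F))
  (disp : measure_display) (Omega : measurableType disp)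
  (P : probability Omega R)
  (ik : nat -> {RV P >-> 'I_n.+1}) (p : 'I_n.+1 -> R)
  (p_gt0 : forall i, 0 < p i)
  (ik_iid : iid_with_law ik p)
  (tau : nat) (d : nat -> 'I_n.+1 -> nat)
  (d_le : forall k i, (d k i <= minn k tau)%N)
  (gam : 'I_n.+1 -> R) (gam_gt0 : forall i, 0 < gam i)
  (x0 : direct_sum H) (F_x0 : (F x0 < +oo)%E)
  (x : nat -> Omega -> direct_sum H)
  (x_alg : forall w, async_fb f g gam d x0 (fun k => ik k w) (fun k => x k w))
  (delta : R) (delta_def : delta = delta_step L gam p tau Lres)
  (delta_lt2 : delta < 2)
  (X : set (direct_sum H)) (CX : R)
  (x_in_X : {ae P, forall w, forall k, X (x k w)})
  (CX_gt0 : 0 < CX)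
  (error_bound : forall y, X y ->
     wdist gam y (argmin F) <=
     CX * wnorm gam
       (y - prox_wrt (wnorm gam) (sep_sum g) (y - grad_wrt (winner gam) f y))) :
  let kap := kappa CX delta in
  let the := theta gam p tau Lres delta in
  let rho := 1 - imin p / (kap + the) in
  [/\ kap = Num.max 1 (2 * CX / (2 - delta)),
      the <= Num.sqrt (imin p) / (imax p * (2 - delta)) *
             (imax p ^+ 2 / Num.sqrt (imin p) + 1),
      forall k : nat,
        (\int[P]_w (F (x k.+1 w) - Fstar) <=
         (rho ^+ (k.+1 %/ tau.+1))%:E * \int[P]_w (F (x 0%N w) - Fstar))%E &
      exists xstar : Omega -> direct_sum H,
        [/\ measurable_fun [set: Omega]
              (xstar : Omega -> g_sigma_algebraType (@open (direct_sum H))),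
            forall w, argmin F (xstar w),
            {ae P, forall w, x k w @[k --> \oo] --> xstar w} &
            exists C : R, \forall k \near \oo,
              ('E_P[fun w => wnorm gam (x k w - xstar w)%R] <=
               (C * rho `^ ((k %/ tau.+1)%:R / 2))%:E)%E]].
Proof.
move=> kap the rho.
have F_E y : F y = ((f y)%:E + sep_sum g y)%E by rewrite F_def.
have F_dom y : (F y < +oo)%E -> in_dom g y.
  move=> Fy; apply: sep_sum_dom => //; move: Fy; rewrite F_E.
  by case: (sep_sum g y) => [s| |]//; rewrite !ltry.
have F_fin y : in_dom g y -> F y = (objective f g y)%:E.
  by move=> gy; rewrite F_E sep_sum_fin// -EFinD.
have x0_dom := F_dom _ F_x0.
have [z0 z0_min] := F_attains.
have argmin_dom z : argmin F z -> in_dom g z.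
  by move=> zmin; apply: F_dom; exact: le_lt_trans (zmin x0) F_x0.
pose Fs := objective f g z0.
have F_z0 : F z0 = Fs%:E by apply: F_fin; exact: argmin_dom.
have FstarE : Fstar = Fs%:E.
  rewrite Fstar_def -F_z0; apply/eqP; rewrite eq_le; apply/andP; split.
    by apply: ereal_inf_lbound; exists z0.
  by apply: le_ereal_inf_tmp => _ [y _ <-]; exact: z0_min.
have S_min z : argmin F z -> in_dom g z /\ objective f g z = Fs.
  move=> zmin; have domz := argmin_dom _ zmin; split=> //.
  apply: EFin_inj; rewrite -F_z0 -(F_fin z domz).
  by apply/eqP; rewrite eq_le zmin z0_min.
have Fs_le z : in_dom g z -> Fs <= objective f g z.
  by move=> domz; rewrite -lee_fin -(F_fin z domz) -F_z0 z0_min.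
have x_X k w : X (x k w).
  apply: (adapted_ae p_gt0 ik_iid (k := k) (h := x k)).
    by move=> w1 w2; exact: (adapted_async x_alg).
  by move: x_in_X; apply: filterS => w' Xw'; exact: Xw'.
have eb k w : wdist gam (x k w) (argmin F) <=
    CX * wnorm gam (fun i => fb_dir f g gam (x k w) (x k w) i).
  have := error_bound (x k w) (x_X k w).
  rewrite prox_wrt_wnorm// grad_wrt_winner// -wnormN opprB.
  congr (_ <= _ * wnorm gam _); apply/functional_extensionality_dep => i.
  by rewrite /fb_dir -lock.
have gapE k w : (F (x k w) - Fstar = (gap f g x Fs k w)%:E)%E.
  rewrite FstarE F_fin -?EFinB//.
  exact: (async_in_dom g_proper g_convex g_lsc gam_gt0 x0_dom x_alg).
have int_gap k : (\int[P]_w (F (x k w) - Fstar) = (Rintegral P setT (gap f g x Fs k))%:E)%E.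
  under eq_integral do rewrite gapE.
  by apply: (EFin_expect (k := k)) => w1 w2; exact: (adapted_gap x_alg).
have rate := expect_gap_rate f_convex f_diff g_proper g_convex g_lsc gam_gt0 Lres_gt0
  L_ge0 grad_lip grad_block_lip p_gt0 ik_iid d_le x0_dom x_alg CX_gt0 delta_def
  delta_lt2 F_attains S_min eb.
split.
- exact: kappa_max.
- exact: theta_le L_ge0 p_gt0 gam_gt0 delta_def delta_lt2.
- by move=> k; rewrite !int_gap -EFinM lee_fin; exact: rate.
exists (async_limit f g x Fs z0); split.
- exact: (measurable_async_limit g_proper g_convex g_lsc gam_gt0 x0_dom x_alg Fs_le).
- move=> w y; rewrite F_E.
  apply: le_trans (async_limit_min f_diff g_proper g_convex g_lsc gam_gt0 x0_dom x_alg
    S_min Fs_le z0_min w) _.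
  by rewrite -F_z0; exact: z0_min.
- exact: (async_limit_cvg f_convex f_diff g_proper g_convex g_lsc gam_gt0 Lres_gt0
    L_ge0 grad_lip grad_block_lip p_gt0 ik_iid d_le x0_dom x_alg CX_gt0 delta_def
    delta_lt2 F_attains S_min Fs_le eb).
have [c hc] := async_limit_rate f_convex f_diff g_proper g_convex g_lsc gam_gt0 Lres_gt0
    L_ge0 grad_lip grad_block_lip p_gt0 ik_iid d_le x0_dom x_alg CX_gt0 delta_def
    delta_lt2 F_attains S_min Fs_le eb z0.
exists c; apply: nearW => k; rewrite unlock.
have -> : rho `^ ((k %/ tau.+1)%:R / 2) = Num.sqrt rho ^+ (k %/ tau.+1).
  rewrite mulrC powRrM powR12_sqrt ?powR_mulrn ?sqrtr_ge0//.
  exact: (rho_ge0 gam_gt0 Lres_gt0 p_gt0 ik_iid).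
exact: hc.
Qed.
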